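(* Let $P\in\mathbb{C}[x,y_0,\ldots,y_n]$ with $P\neq0$, and let $s(x)\in\Omega$ be a solution of $P=0$ (i.e. $P(x,s(x),s'(x),\ldots,s^{(n)}(x))=0$) whose support has maximal rational rank, that is \[ \dim_{\mathbb{Q}}\frac{\langle\operatorname{supp}s(x)\cup\operatorname{supp}P\rangle}{\langle\operatorname{supp}P\rangle}=n . \] Then $s(x)$ converges uniformly in any sector $S$ of sufficiently small radius with vertex at the origin and of opening less than $2\pi$.
   Context: $\Omega$ denotes the field of generalized power series $s(x)=\sum_{i\ge1}c_i x^{\mu_i}$ with $c_i\in\mathbb{C}$, $\mu_i\in\mathbb{R}$, $\mu_1<\mu_2<\cdots$ and $\mu_i\to\infty$ when there are infinitely many terms; $\operatorname{supp}s=\{\mu_i:c_i\ne0\}$. For $P\in\mathbb{C}[x,y_0,\ldots,y_n]$, viewed as a polynomial in $y_0,\ldots,y_n$ with coefficients in $\mathbb{C}[x]\subset\Omega$, $\operatorname{supp}P$ is the union of the supports of these coefficients (so $\langle\operatorname{supp}P\rangle$ is $\{0\}$ or $\mathbb{Q}$). For $E\subset\mathbb{R}$, $\langle E\rangle$ is the $\mathbb{Q}$-linear span of $E$. The operator $'$ is one fixed choice among: (a) ordinary derivative $\frac{d}{dx}$; (b) Euler derivative $x\frac{d}{dx}$; (c) $q$-difference operator $s'(x)=s(qx)$, i.e. $\sum c_ix^{\mu_i}\mapsto\sum c_iq^{\mu_i}x^{\mu_i}$, for fixed $q\in\mathbb{C}$, $|q|\ne1$. $s^{(\kappa)}$ is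 the $\kappa$-th iterate of $'$. *)

(* Defs.v *)
From HB Require Import structures.
From mathcomp Require Import all_boot all_order all_algebra.
From mathcomp Require Import boolp classical_sets cardinality fsbigop reals.
From mathcomp Require Import exp trigo.
From mathcomp Require Import complex.
From mathcomp Require Import mpoly.

Set Implicit Arguments.
Unset Strict Implicit.
Unset Printing Implicit Defensive.

Import Order.TTheory GRing.Theory Num.Theory.
Local Open Scope classical_set_scope.
Local Open Scope ring_scope.
Local Open Scope complex_scope.

Section GPS.
Variable R : realType.
Local Notation C := R[i].

(** A generalized power series  s = sum_i c_i x^(mu_i)  is represented by its
    coefficient function  mu |-> coefficient of x^mu. *)
Definition supp (s : R -> C) : set R := [set mu | s mu != 0].

(** Element of Omega: the support is finite below every bound, i.e. it is
    finite or a strictly increasing sequence tending to +oo. *)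
Definition is_gps (s : R -> C) : Prop :=
  forall M : R, finite_set [set mu | s mu != 0 /\ mu < M].

Definition cis (t : R) : C := (cos t) +i* (sin t).

(** The operator ':  d/dx, x d/dx, or s(x) |-> s(qx).  For the q-difference
    operator, q is given in polar form q = a e^(i t) (a > 0, a <> 1), which
    fixes the branch q^mu := a^mu e^(i mu t). *)
Inductive sigma_op := DerivOp | EulerOp | QDiffOp of R & R.

Definition op_ok (o : sigma_op) : Prop :=
  match o with QDiffOp a _ => 0 < a /\ a != 1 | _ => True end.

Definition qpow (a t mu : R) : C := (a `^ mu)%:C * cis (mu * t).

Definition apply_op (o : sigma_op) (s : R -> C) : R -> C :=
  match o with
  | DerivOp => fun mu => (mu + 1)%:C * s (mu + 1)
  | EulerOp => fun mu => mu%:C * s mu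
  | QDiffOp a t => fun mu => qpow a t mu * s mu
  end.

Definition op_iter (o : sigma_op) (k : nat) (s : R -> C) : R -> C :=
  iter k (apply_op o) s.

Definition gps_zero : R -> C := fun _ => 0.
Definition gps_one : R -> C := fun mu => if mu == 0 then 1 else 0.
Definition gps_add (f g : R -> C) : R -> C := fun mu => f mu + g mu.
Definition gps_scale (c : C) (f : R -> C) : R -> C := fun mu => c * f mu.
Definition gps_mul (f g : R -> C) : R -> C :=
  fun mu => \sum_(a \in [set: R]) f a * g (mu - a).
Definition gps_exp (f : R -> C) (k : nat) : R -> C := iter k (gps_mul f) gps_one.
Definition gps_xpow (k : nat) : R -> C := fun mu => if mu == k%:R then 1 else 0.

(** P in C[x, y_0, ..., y_n]: variable 0 is x, variable i.+1 is y_i. *)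
Definition eval_diff (n : nat) (P : mpoly.mpoly n.+2 C) (o : sigma_op)
    (s : R -> C) : R -> C :=
  \big[gps_add/gps_zero]_(m <- mpoly.msupp P)
     gps_scale (mpoly.mcoeff m P)
       (gps_mul (gps_xpow (mpoly.fun_of_multinom m ord0))
          (\big[gps_mul/gps_one]_(i < n.+1)
              gps_exp (op_iter o i s) (mpoly.fun_of_multinom m (lift ord0 i)))).

(** supp P: union of the supports of the coefficients of P in C[x]. *)
Definition suppP (n : nat) (P : mpoly.mpoly n.+2 C) : set R :=
  [set ((mpoly.fun_of_multinom m ord0)%:R : R) | m in [set m : mpoly.multinom n.+2 | m \in mpoly.msupp P]].

End GPS.

Section Rank.
Variable R : realType.

Definition Qspan (E : set R) : set R :=
  [set x | exists (k : nat) (q : 'I_k -> rat) (e : 'I_k -> R),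
      (forall i, E (e i)) /\ x = \sum_(i < k) ratr (q i) * e i].

Definition quot_dim_eq (A B : set R) (n : nat) : Prop :=
  exists v : 'I_n -> R,
    (forall i, Qspan A (v i)) /\
    (forall q : 'I_n -> rat, Qspan B (\sum_(i < n) ratr (q i) * v i) ->
        forall i, q i = 0) /\
    (forall a, Qspan A a -> exists (q : 'I_n -> rat) (b : R),
        Qspan B b /\ a = b + \sum_(i < n) ratr (q i) * v i).

End Rank.

Section Conv.
Variable R : realType.
Local Notation C := R[i].

(** Truncation  sum_{mu < M} c_mu x^mu  evaluated at x = rho e^(i theta),
    with x^mu := rho^mu e^(i mu theta)  (branch given by theta). *)
Definition trunc (s : R -> C) (M rho theta : R) : C :=
  \sum_(mu \in [set mu : R | mu < M]) s mu * (rho `^ mu)%:C * cis (mu * theta).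

(** The open sector of radius r, vertex 0, directions (th0, th0 + al),
    in polar coordinates (the argument is taken in (th0, th0 + al)). *)
Definition in_sector (r th0 al rho theta : R) : Prop :=
  0 < rho < r /\ th0 < theta < th0 + al.

Definition unif_conv_sector (s : R -> C) (r th0 al : R) : Prop :=
  exists f : R -> R -> C, forall eps : R, 0 < eps ->
    exists M0 : R, forall M, M0 <= M -> forall rho theta,
      in_sector r th0 al rho theta -> `|trunc s M rho theta - f rho theta| < eps%:C.

End Conv.

(* Main.v *)
Require Import Defs.
From HB Require Import structures.
From mathcomp Require Import all_boot all_order all_algebra.
From mathcomp Require Import boolp classical_sets cardinality fsbigop reals.
From mathcomp Require Import exp trigo.
From mathcomp Require Import complex.
From mathcomp Require Import mpoly.
From mathcomp Require Import ring lra.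

(** The linearization of [P] at [s] may vanish identically. [P] is therefore traded for an iterated
    partial derivative [Q] that still vanishes at [s] but has a nonzero partial derivative in some
    [y_j] there. As [Q] is not known in advance, the [n] series must solve the linearized equation
    of every candidate; this works because the only property of [P] used, absence of [x] in the case
    where it matters, survives differentiation.

    The degree of the indicial polynomial is the crux. If it were smaller than [n], some multiplier
    [m_j(mu)] could outgrow [Phi(mu)], and each step of the recursion could lose a factor growing
    with [mu], as for the divergent series at an irregular singular point.

    The truncation [p] has to be long for two reasons: replacing [s] by [p] must not alter the
    leading terms of the linearized operator, and the quadratic Taylor remainder must start beyond
    them. Hence the Taylor constants must not depend on the truncation level.

    All estimates involve [|x|] only, so one radius serves sectors of every opening. *)

(** Deriving [P(x, s, s', ...) = 0] along derivations that commute with the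
    operator and kill the coefficients of [P] yields [n] independent solutions
    of the equation linearized at [s]: a Q-linear functional [l] on exponents
    gives the derivation [x^mu |-> l(mu) x^mu].  Their [n] distinct leading
    exponents are roots of the indicial polynomial of the linearized operator,
    which has degree at most [n]; hence it has degree exactly [n], the operator
    is of regular singular type, and its symbol [Phi(mu)] dominates all the
    multipliers [m_j(mu)] of [s^(j)] as [mu] grows.  Splitting [s = p + u] with
    [p] a long truncation and [u] the tail, the equation reads
    [Phi(mu) u_mu = h_mu] where [h] only involves [u_kappa] with
    [kappa <= mu - d], so that the weighted norms
    [sum_(mu < M) |Phi(mu) u_mu| r^mu] remain bounded, for [r] small, as [M]
    increases by steps of [d]. *)

Set Implicit Arguments.
Unset Strict Implicit.
Unset Printing Implicit Defensive.

Import Order.TTheory GRing.Theory Num.Theory.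
Local Open Scope classical_set_scope.
Local Open Scope ring_scope.
Local Open Scope complex_scope.

(** * The ring of generalized power series *)

Section GpsRing.
Variable R : realType.
Local Notation C := R[i].
Implicit Types (f g h : R -> C) (mu M : R).

Lemma is_gpsP f :
  (forall M, exists S : seq R, forall mu, f mu != 0 -> mu < M -> mu \in S) ->
  is_gps f.
Proof.
move=> H M; have [S HS] := H M.
apply: (@sub_finite_set _ _ [set` S]); last by apply/finite_seqP; exists S.
by move=> mu [fmu ltM] /=; apply: HS.
Qed.

Lemma is_gps_seq f M : is_gps f ->
  exists S : seq R, uniq S /\
    forall mu, (mu \in S) = (f mu != 0) && (mu < M).
Proof.
move=> /(_ M)/finite_seqP[S eS]; exists (undup S); split; first exact: undup_uniq.
move=> mu; rewrite mem_undup.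
apply/idP/andP => [muS|H].
  by have : [set` S] mu by []; rewrite -eS.
by have : [set` S] mu by rewrite -eS.
Qed.

Lemma is_gps_lb f : is_gps f -> exists m, forall mu, f mu != 0 -> m <= mu.
Proof.
move=> /(is_gps_seq 0)[S [_ HS]].
have [m [m0 Hm]] : exists m, m <= 0 /\ forall x, x \in S -> m <= x.
  elim: S {HS} => [|x S [m [m0 Hm]]]; first by exists 0.
  exists (Order.min x m); split=> [|y]; first by rewrite ge_min m0 orbT.
  by rewrite inE ge_min => /predU1P[->|/Hm ->]; rewrite ?lexx ?orbT.
exists m => mu fmu; have [lt0|ge0] := ltP mu 0; last exact: le_trans ge0.
by apply: Hm; rewrite HS fmu.
Qed.

(** Any list containing the contributing exponents will do, so an identity between products can be
    checked over one common finite list. *)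
Lemma gps_mul_seq f g mu (S : seq R) : uniq S ->
  (forall a, f a != 0 -> g (mu - a) != 0 -> a \in S) ->
  gps_mul f g mu = \sum_(a <- S) f a * g (mu - a).
Proof.
move=> uS HS; rewrite /gps_mul (fsbigE S) //.
  by apply: eq_bigl => a; rewrite in_setT.
move=> a _ aS.
apply/eqP; rewrite mulf_eq0; apply: contraR aS; rewrite negb_or => /andP[fa ga].
exact: HS.
Qed.

Lemma gps_mul_supp f g mu : gps_mul f g mu != 0 ->
  exists2 a, f a != 0 & g (mu - a) != 0.
Proof.
move=> H; apply: contrapT => /forall2NP N.
move: H; rewrite (@gps_mul_seq _ _ _ [::]) ?big_nil ?eqxx // => a fa ga.
by have [] := N a; rewrite ?fa ?ga.
Qed.

Lemma gps_mul_seq_lt f g mu (S : seq R) M b : uniq S ->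
  (forall a, (a \in S) = (f a != 0) && (a < M)) ->
  (forall a, g a != 0 -> b <= a) -> mu < M + b ->
  gps_mul f g mu = \sum_(a <- S) f a * g (mu - a).
Proof.
move=> uS HS Hb ltM; apply: gps_mul_seq => // a fa /Hb ba.
by rewrite HS fa /=; lra.
Qed.

Lemma is_gps_mul f g : is_gps f -> is_gps g -> is_gps (gps_mul f g).
Proof.
move=> gf gg; have [mf Hmf] := is_gps_lb gf; have [mg Hmg] := is_gps_lb gg.
apply: is_gpsP => M.
have [Sf [_ HSf]] := is_gps_seq (M - mg) gf.
have [Sg [_ HSg]] := is_gps_seq (M - mf) gg.
exists [seq a + b | a <- Sf, b <- Sg] => mu /gps_mul_supp[a fa ga] ltM.
apply/allpairsP; exists (a, mu - a); split; rewrite /= ?HSf ?HSg ?fa ?ga /=.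
- by have := Hmg _ ga; lra.
- by have := Hmf _ fa; lra.
- by rewrite addrC subrK.
Qed.

Lemma is_gps_add f g : is_gps f -> is_gps g -> is_gps (gps_add f g).
Proof.
move=> gf gg; apply: is_gpsP => M.
have [Sf [_ HSf]] := is_gps_seq M gf.
have [Sg [_ HSg]] := is_gps_seq M gg.
exists (Sf ++ Sg) => mu H ltM; rewrite mem_cat HSf HSg ltM !andbT -negb_and.
apply: contra H => /andP[/eqP f0 /eqP g0].
by rewrite /gps_add f0 g0 addr0.
Qed.

Lemma is_gps_weight (w f : R -> C) : is_gps f -> is_gps (fun mu => w mu * f mu).
Proof.
move=> gf; apply: is_gpsP => M; have [S [_ HS]] := is_gps_seq M gf.
exists S => mu H ltM; rewrite HS ltM andbT; apply: contraNN H => /eqP ->.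
by rewrite mulr0.
Qed.

Lemma is_gps_shift (d : R) f : is_gps f -> is_gps (fun mu => f (mu + d)).
Proof.
move=> gf; apply: is_gpsP => M; have [S [_ HS]] := is_gps_seq (M + d) gf.
exists [seq a - d | a <- S] => mu H ltM; apply/mapP; exists (mu + d); last by rewrite addrK.
by rewrite HS H /=; lra.
Qed.

Lemma is_gps_single (c : C) (d : R) : is_gps (fun mu => if mu == d then c else 0).
Proof.
apply: is_gpsP => M; exists [:: d] => mu; rewrite inE.
by case: (mu =P d) => //; rewrite eqxx.
Qed.

Lemma gps_mulC f g : gps_mul f g = gps_mul g f.
Proof.
apply/funext => mu; rewrite /gps_mul.
rewrite (@reindex_fsbigT _ _ _ R R (fun a => mu - a)); last first.
  by exists (fun a => mu - a) => a; rewrite opprB addrC subrK.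
by apply: eq_fsbigr => a _; rewrite subKr mulrC.
Qed.

Lemma gps_mulA f g h : is_gps f -> is_gps g -> is_gps h ->
  gps_mul f (gps_mul g h) = gps_mul (gps_mul f g) h.
Proof.
move=> gf gg gh; apply/funext => mu.
have [mf Hmf] := is_gps_lb gf; have [mg Hmg] := is_gps_lb gg.
have [mh Hmh] := is_gps_lb gh.
(* If [a + b + c = mu] with [b >= mg] and [c >= mh], then [a <= mu - mg - mh]; the extra 1 makes
   this strict. [A] collects the possible sums [a + b]. *)
have [F [uF HF]] := is_gps_seq (mu - mg - mh + 1) gf.
have [G [uG HG]] := is_gps_seq (mu - mf - mh + 1) gg.
pose A := undup [seq a + b | a <- F, b <- G].
rewrite [LHS](gps_mul_seq uF); last first.
  move=> a fa /gps_mul_supp[b gb hb]; rewrite HF fa /=.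
  by have := Hmg _ gb; have := Hmh _ hb; lra.
rewrite [RHS](@gps_mul_seq _ _ _ A) ?undup_uniq //; last first.
  move=> c /gps_mul_supp[a fa gb] hc; rewrite mem_undup; apply/allpairsP.
  exists (a, c - a) => /=; rewrite [a + _]addrC subrK HF HG fa gb /=.
  by have := Hmf _ fa; have := Hmg _ gb; have := Hmh _ hc; split=> //; lra.
transitivity (\sum_(c <- A) \sum_(a <- F) f a * g (c - a) * h (mu - c)); last first.
  rewrite big_seq [RHS]big_seq; apply: eq_bigr => c; rewrite mem_undup => /allpairsP[[a b] /= [aF bG cE]].
  rewrite -mulr_suml.
  have [->|hc] := eqVneq (h (mu - c)) 0; first by rewrite !mulr0.
  congr (_ * _); symmetry; apply: gps_mul_seq => // a' fa' gb'; rewrite HF fa' /=.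
  by have := Hmg _ gb'; have := Hmh _ hc; lra.
rewrite exchange_big /= big_seq [RHS]big_seq; apply: eq_bigr => a aF.
under eq_bigr do rewrite -mulrA.
rewrite -mulr_sumr; congr (_ * _).
rewrite (@gps_mul_seq _ _ _ [seq c - a | c <- A]); first last.
- move=> b gb hb; apply/mapP; exists (a + b); last by lra.
  rewrite mem_undup; apply/allpairsP; exists (a, b); split=> //=.
  rewrite HG gb /=; move: aF; rewrite HF => /andP[/Hmf fa _].
  by have := Hmh _ hb; lra.
- by rewrite map_inj_uniq ?undup_uniq //; exact: addIr.
by rewrite big_map; apply: eq_bigr => c _; congr (_ * h _); lra.
Qed.

Lemma gps_single_mul (c : C) (d : R) g mu :
  gps_mul (fun nu => if nu == d then c else 0) g mu = c * g (mu - d).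
Proof.
rewrite (@gps_mul_seq _ _ _ [:: d]) //; first by rewrite big_seq1 eqxx.
by move=> a; rewrite inE; case: (a =P d) => //; rewrite eqxx.
Qed.

Lemma gps_mul1 g : gps_mul (@gps_one R) g = g.
Proof. by apply/funext => mu; rewrite gps_single_mul subr0 mul1r. Qed.

Lemma gps_mulDl f g h : is_gps f -> is_gps g -> is_gps h ->
  gps_mul (gps_add f g) h = gps_add (gps_mul f h) (gps_mul g h).
Proof.
move=> gf gg gh; apply/funext => mu; rewrite /gps_add.
have [mh Hmh] := is_gps_lb gh.
have [F [uF HF]] := is_gps_seq (mu - mh + 1) gf.
have [G [uG HG]] := is_gps_seq (mu - mh + 1) gg.
have uS : uniq (undup (F ++ G)) by rewrite undup_uniq.
rewrite !(gps_mul_seq uS); first by rewrite -big_split; apply: eq_bigr => a _; rewrite mulrDl.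
all: move=> a fa /Hmh ha; rewrite mem_undup mem_cat HF HG.
- by rewrite fa orbC /=; apply/orP; left; lra.
- by rewrite fa /=; apply/orP; left; lra.
- apply/orP; have [f0|f0] := eqVneq (f a) 0; [right|left]; last by lra.
  by move: fa; rewrite f0 add0r => -> /=; lra.
Qed.

(** Bundling the finiteness condition yields a commutative ring, in which [mmap] can evaluate
    differential polynomials. *)
Record gps := Gps { gcoef :> R -> C; gcoefP : is_gps gcoef }.

Lemma gpsP (a b : gps) : (forall mu, a mu = b mu) -> a = b.
Proof.
case: a => a pa; case: b => b pb /= /funext ab; subst b.
by congr Gps; exact: Prop_irrelevance.
Qed.

HB.instance Definition _ := gen_eqMixin gps.
HB.instance Definition _ := gen_choiceMixin gps.

Lemma is_gps0 : is_gps (@gps_zero R).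
Proof. by apply: is_gpsP => M; exists [::] => mu; rewrite eqxx. Qed.

Definition gadd (a b : gps) := Gps (is_gps_add (gcoefP a) (gcoefP b)).
Definition gmul (a b : gps) := Gps (is_gps_mul (gcoefP a) (gcoefP b)).
Definition gopp (a : gps) := Gps (is_gps_weight (fun=> -1) (gcoefP a)).
Definition gzero := Gps is_gps0.
Definition gmono (c : C) (d : R) := Gps (is_gps_single c d).

Lemma gaddA : associative gadd.
Proof. by move=> a b c; apply: gpsP => mu /=; rewrite /gps_add /= addrA. Qed.
Lemma gaddC : commutative gadd.
Proof. by move=> a b; apply: gpsP => mu /=; rewrite /gps_add /= addrC. Qed.
Lemma gadd0 : left_id gzero gadd.
Proof. by move=> a; apply: gpsP => mu /=; rewrite /gps_add /= add0r. Qed.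
Lemma gaddN : left_inverse gzero gopp gadd.
Proof. by move=> a; apply: gpsP => mu /=; rewrite /gps_add /= mulN1r addNr. Qed.
HB.instance Definition _ := GRing.isZmodule.Build gps gaddA gaddC gadd0 gaddN.

Lemma gmulA : associative gmul.
Proof. by move=> a b c; apply: gpsP => mu /=; rewrite gps_mulA //; exact: gcoefP. Qed.
Lemma gmulC : commutative gmul.
Proof. by move=> a b; apply: gpsP => mu /=; rewrite gps_mulC. Qed.
Lemma gmul1 : left_id (gmono 1 0) gmul.
Proof. by move=> a; apply: gpsP => mu /=; rewrite gps_mul1. Qed.
Lemma gmulDl : left_distributive gmul gadd.
Proof. by move=> a b c; apply: gpsP => mu /=; rewrite gps_mulDl //; exact: gcoefP. Qed.
Lemma g1neq0 : gmono 1 0 != gzero.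
Proof.
apply/eqP => /(congr1 (fun a : gps => a 0)) /=; rewrite eqxx => /eqP.
by rewrite oner_eq0.
Qed.
HB.instance Definition _ :=
  GRing.Zmodule_isComNzRing.Build gps gmulA gmulC gmul1 gmulDl g1neq0.

Lemma gcoefD (a b : gps) mu : (a + b) mu = a mu + b mu. Proof. by []. Qed.
Lemma gcoef0 mu : (0 : gps) mu = 0. Proof. by []. Qed.
Lemma gcoefN (a : gps) mu : (- a) mu = - a mu.
Proof. by rewrite /= mulN1r. Qed.
Lemma gcoefB (a b : gps) mu : (a - b) mu = a mu - b mu.
Proof. by rewrite gcoefD gcoefN. Qed.
Lemma gcoef_sum (I : Type) (r : seq I) (P : pred I) (F : I -> gps) mu :
  (\sum_(i <- r | P i) F i) mu = \sum_(i <- r | P i) F i mu.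
Proof. exact: (big_morph (fun a : gps => a mu) (fun a b => gcoefD a b mu) (gcoef0 mu)). Qed.
Lemma gcoefM (a b : gps) : a * b = gps_mul a b :> (R -> C). Proof. by []. Qed.
Lemma gcoef_monoM (c : C) (d : R) (a : gps) mu : (gmono c d * a) mu = c * a (mu - d).
Proof. exact: gps_single_mul. Qed.
Lemma gmonoE (c : C) (d mu : R) : gmono c d mu = if mu == d then c else 0.
Proof. by []. Qed.
Lemma gmonoM (c c' : C) (d d' : R) : gmono c d * gmono c' d' = gmono (c * c') (d + d').
Proof.
apply: gpsP => mu; rewrite gcoef_monoM !gmonoE subr_eq [d' + d]addrC.
by case: eqP; rewrite ?mulr0.
Qed.

Definition gconst (c : C) : gps := gmono c 0.
Lemma gconst_is_additive : {morph gconst : a b / a - b}.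
Proof. by move=> a b; apply: gpsP => mu; rewrite gcoefB !gmonoE; case: eqP; rewrite ?subr0. Qed.
Lemma gconst_is_monoid_morphism : monoid_morphism gconst.
Proof. by split=> // a b; rewrite gmonoM addr0. Qed.
HB.instance Definition _ := GRing.isZmodMorphism.Build C gps gconst gconst_is_additive.
HB.instance Definition _ := GRing.isMonoidMorphism.Build C gps gconst gconst_is_monoid_morphism.

Lemma gconstE (c : C) mu : gconst c mu = if mu == 0 then c else 0.
Proof. by []. Qed.

Lemma gcoef_constM (c : C) (a : gps) mu : (gconst c * a) mu = c * a mu.
Proof. by rewrite gcoef_monoM subr0. Qed.

End GpsRing.

(* Without this, unification of ring expressions unfolds the series operations
   and becomes intractable. *)
#[global] Opaque gadd gmul gopp gzero gmono gconst.

(** * Taylor expansion and derivations along polynomial evaluation *)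

Section MpolyInduction.
Variables (A : comNzRingType) (k : nat).

(** Induction along ring operations suits the chain rule and the Taylor estimate, which both pass
    from two polynomials to their sum and product. *)
Lemma mpoly_ring_ind (T : {mpoly A[k]} -> Prop) :
  (forall c, T c%:MP) -> (forall i, T 'X_i) ->
  (forall p q, T p -> T q -> T (p + q)) ->
  (forall p q, T p -> T q -> T (p * q)) -> forall p, T p.
Proof.
move=> TC TX TD TM; elim/mpolyind => [|c m p _ _ Tp]; first by rewrite -(mpolyC0 k A).
apply: (TD) => //; rewrite -mul_mpolyC; apply: (TM) => //.
have T1 : T 1 by rewrite -(mpolyC1 k A).
rewrite mpolyXE_id; apply: (big_ind T T1 TM) => i _.
by elim: (m i) => [|d IH]; rewrite ?expr0 // exprS; apply: TM.
Qed.

Lemma mderivXU (i j : 'I_k) : ('X_j : {mpoly A[k]})^`M(i) = (i == j)%:R.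
Proof.
rewrite mderivX mnm1E eq_sym; case: eqP => [->|_]; last by rewrite scale0r.
by rewrite scale1r -[X in (X - _)%MM]add0m addmK mpolyX0.
Qed.

Lemma msize_mderiv (Q : {mpoly A[k]}) i : Q^`M(i) != 0 -> (msize Q^`M(i) < msize Q)%N.
Proof.
move=> nz; set m := mlead Q^`M(i).
have mQ : m \in msupp Q^`M(i) by exact: mlead_supp.
rewrite -(mlead_deg nz) -/m.
have : (m + U_(i))%MM \in msupp Q.
  by move: mQ; rewrite !mcoeff_msupp mcoeff_deriv; apply: contraNN => /eqP ->; rewrite mul0rn.
by move=> /msize_mdeg_lt; rewrite mdegD mdeg1 addn1.
Qed.

End MpolyInduction.

Section Filtration.
Variables (R : realFieldType) (A S : comNzRingType) (phi : {rmorphism A -> S}) (k : nat).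
Local Notation gev := (mmap phi).
Implicit Types (F : R -> S -> Prop) (Y T : 'I_k -> S) (Q : {mpoly A[k]}).

Lemma mmap_mderivD Y T p q : \sum_i gev Y (p + q)^`M(i) * T i =
  \sum_i gev Y p^`M(i) * T i + \sum_i gev Y q^`M(i) * T i.
Proof. by rewrite -big_split; apply: eq_bigr => i _; rewrite mderivD mmapD mulrDl. Qed.

Lemma mmap_mderivM Y T p q : \sum_i gev Y (p * q)^`M(i) * T i =
  (\sum_i gev Y p^`M(i) * T i) * gev Y q + gev Y p * \sum_i gev Y q^`M(i) * T i.
Proof.
rewrite mulr_suml mulr_sumr -big_split; apply: eq_bigr => i _.
by rewrite mderivM mmapD !rmorphM /=; ring.
Qed.

(** [D] needs to be a derivation on [U] only; [U] will be the series supported in a set of exponents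
    where a weight is additive. *)
Lemma mmap_chain_rule (U : S -> Prop) (D : S -> S) Y Q :
  (forall c, U (phi c)) -> (forall c, D (phi c) = 0) ->
  (forall f g, U f -> U g -> [/\ U (f + g), U (f * g), D (f + g) = D f + D g
                               & D (f * g) = D f * g + f * D g]) ->
  (forall i, U (Y i)) ->
  D (gev Y Q) = \sum_i gev Y Q^`M(i) * D (Y i).
Proof.
move=> UC DC UD UY; suff : U (gev Y Q) /\
  D (gev Y Q) = \sum_i gev Y Q^`M(i) * D (Y i) by case.
elim/mpoly_ring_ind: Q => [c|j|p q [p1 p2] [q1 q2]|p q [p1 p2] [q1 q2]].
- rewrite mmapC; split; first exact: UC.
  rewrite big1 => [|i _]; last by rewrite mderivC raddf0 mul0r.
  exact: DC.
- rewrite mmapX mmap1U; split; first exact: UY.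
  rewrite (bigD1 j) //= big1 => [|i ij].
    by rewrite mderivXU eqxx rmorph1 mul1r addr0.
  by rewrite mderivXU (negbTE ij) raddf0 mul0r.
- by have [? _ E _] := UD _ _ p1 q1; rewrite mmapD E p2 q2 mmap_mderivD.
- by have [_ ? _ E] := UD _ _ p1 q1; rewrite !rmorphM /= E p2 q2 mmap_mderivM.
Qed.

(** [F a f] plays the role of [f = O(x^a)]. Keeping it abstract lets one Taylor estimate carry
    orders and norm bounds together, through the instance [good]. *)
Record filtration F : Prop := Filtration {
  filt_le : forall a b f, a <= b -> F b f -> F a f;
  filt_0 : forall a, F a 0;
  filt_const : forall c : A, F 0 (phi c);
  filt_add : forall a f g, F a f -> F a g -> F a (f + g);
  filt_mul : forall a b f g, F a f -> F b g -> F (a + b) (f * g) }.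

Lemma filt_opp F a f : filtration F -> F a f -> F a (- f).
Proof.
move=> HF Ff; rewrite -mulN1r -[a]add0r; apply: filt_mul => //.
have -> : -1 = phi (-1) :> S by rewrite rmorphN1.
exact: filt_const.
Qed.

Lemma filt_sub F a f g : filtration F -> F a f -> F a g -> F a (f - g).
Proof. by move=> HF Ff Fg; apply: filt_add => //; apply: filt_opp. Qed.

Lemma filt_sum F a (I : Type) (r : seq I) (f : I -> S) : filtration F ->
  (forall i, F a (f i)) -> F a (\sum_(i <- r) f i).
Proof.
by move=> HF Ff; apply: big_ind => //; [apply: filt_0 | move=> x y; apply: filt_add].
Qed.

(** The order of quantifiers matters: [B] depends on [Q] and [b] alone, so [K] can be chosen
    afterwards, large enough for [2 * K - B] to exceed [K] by any prescribed amount. *)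
Lemma filtration_taylor Q (b : R) : 0 <= b ->
  exists B : R, forall F, filtration F -> forall K, 0 <= K -> forall Y T,
    (forall i, F (- b) (Y i)) -> (forall i, F (K - b) (T i)) ->
    let Q1 := gev (fun i => Y i + T i) Q in
    [/\ F (- B) (gev Y Q), F (K - B) (Q1 - gev Y Q)
      & F (2 * K - B) (Q1 - gev Y Q - \sum_i gev Y Q^`M(i) * T i)].
Proof.
move=> b0; suff [B [_ H]] : exists B : R, 0 <= B /\
    forall F, filtration F -> forall K, 0 <= K -> forall Y T,
    (forall i, F (- b) (Y i)) -> (forall i, F (K - b) (T i)) ->
    let Q1 := gev (fun i => Y i + T i) Q in
    [/\ F (- B) (gev Y Q), F (K - B) (Q1 - gev Y Q)
      & F (2 * K - B) (Q1 - gev Y Q - \sum_i gev Y Q^`M(i) * T i)].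
  by exists B.
elim/mpoly_ring_ind: Q => [c|j|p q [B1 [B10 H1]] [B2 [B20 H2]]|p q [B1 [B10 H1]] [B2 [B20 H2]]].
- exists 0; split=> // F HF K K0 Y T FY FT /=; rewrite !mmapC subrr.
  split; [|exact: filt_0|]; first by rewrite oppr0; apply: filt_const.
  rewrite big1 ?subr0; first exact: filt_0.
  by move=> i _; rewrite mderivC raddf0 mul0r.
- exists b; split=> // F HF K K0 Y T FY FT /=; rewrite !mmapX !mmap1U [Y j + _]addrC addrK.
  split=> //; rewrite (bigD1 j) //= big1 => [|i ij].
    rewrite mderivXU eqxx rmorph1 mul1r addr0 subrr.
    exact: filt_0.
  by rewrite mderivXU (negbTE ij) raddf0 mul0r.
- exists (Order.max B1 B2); split; first by rewrite le_max B10.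
  move=> F HF K K0 Y T FY FT /=.
  have [p1 p2 p3] := H1 F HF K K0 Y T FY FT; have [q1 q2 q3] := H2 F HF K K0 Y T FY FT.
  have m1 : B1 <= Order.max B1 B2 by rewrite le_max lexx.
  have m2 : B2 <= Order.max B1 B2 by rewrite le_max lexx orbT.
  have eqD : gev (fun i => Y i + T i) (p + q) - gev Y (p + q) =
    (gev (fun i => Y i + T i) p - gev Y p) + (gev (fun i => Y i + T i) q - gev Y q).
    by rewrite !mmapD; ring.
  split.
  + rewrite mmapD; apply: filt_add => //.
      by apply: (filt_le HF) p1; lra.
    by apply: (filt_le HF) q1; lra.
  + rewrite eqD; apply: filt_add => //.
      by apply: (filt_le HF) p2; lra.
    by apply: (filt_le HF) q2; lra.
  + rewrite mmap_mderivD eqD opprD addrACA; apply: filt_add => //.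
      by apply: (filt_le HF) p3; lra.
    by apply: (filt_le HF) q3; lra.
- exists (B1 + B2); split; first by rewrite addr_ge0.
  move=> F HF K K0 Y T FY FT /=.
  have [p1 p2 p3] := H1 F HF K K0 Y T FY FT; have [q1 q2 q3] := H2 F HF K K0 Y T FY FT.
  rewrite !rmorphM /=.
  set P1 := gev (fun i => Y i + T i) p in p2 p3 *.
  set Q1 := gev (fun i => Y i + T i) q in q2 q3 *.
  set P0 := gev Y p in p1 p2 p3 *; set Q0 := gev Y q in q1 q2 q3 *.
  (* The last product is of second order and goes to the remainder; the first two give the Leibniz
     rule. *)
  have eqM : P1 * Q1 - P0 * Q0 = (P1 - P0) * Q0 + P0 * (Q1 - Q0) + (P1 - P0) * (Q1 - Q0) by ring.
  split.
  + by rewrite opprD; apply: filt_mul.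
  + rewrite eqM; apply: filt_add => //; first apply: filt_add => //.
    * by have := filt_mul HF p2 q1; apply: (filt_le HF); lra.
    * by have := filt_mul HF p1 q2; apply: (filt_le HF); lra.
    * by have := filt_mul HF p2 q2; apply: (filt_le HF); lra.
  + rewrite mmap_mderivM -/P0 -/Q0 eqM; set dp := \sum_i gev Y p^`M(i) * T i in p3 *.
    set dq := \sum_i gev Y q^`M(i) * T i in q3 *.
    have -> : (P1 - P0) * Q0 + P0 * (Q1 - Q0) + (P1 - P0) * (Q1 - Q0) - (dp * Q0 + P0 * dq) =
      (P1 - P0 - dp) * Q0 + P0 * (Q1 - Q0 - dq) + (P1 - P0) * (Q1 - Q0) by ring.
    apply: filt_add => //; first apply: filt_add => //.
    * by have := filt_mul HF p3 q1; apply: (filt_le HF); lra.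
    * by have := filt_mul HF p1 q3; apply: (filt_le HF); lra.
    * by have := filt_mul HF p2 q2; apply: (filt_le HF); lra.
Qed.

End Filtration.

Section Weights.
Variables (R : realType) (k : nat).
Local Notation C := R[i].
Local Notation gev := (mmap (@gconst R)).
Implicit Types (Q : {mpoly C[k]}).

Definition gweight (l : R -> C) (f : gps R) : gps R :=
  Gps (is_gps_weight l (gcoefP f)).

Lemma gweightD l f g : gweight l (f + g) = gweight l f + gweight l g.
Proof. by apply: gpsP => mu; rewrite gcoefD /= mulrDr. Qed.

(** Relative to [U] because a functional given by rational coordinates is meaningful only on the
    span of the basis. *)
Definition additive_on (U : set R) (l : R -> C) : Prop :=
  [/\ U 0, forall x y, U x -> U y -> U (x + y)
    & forall x y, U x -> U y -> l (x + y) = l x + l y].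

Lemma additive_on0 U l : additive_on U l -> l 0 = 0.
Proof. by case=> U0 _ /(_ 0 0 U0 U0); rewrite addr0 => /eqP; rewrite -subr_eq subrr => /eqP. Qed.

Lemma supp_mul_sub (U : set R) (f g : gps R) :
  (forall x y, U x -> U y -> U (x + y)) ->
  supp f `<=` U -> supp g `<=` U -> supp (f * g) `<=` U.
Proof.
move=> UD fU gU mu /gps_mul_supp[a /fU Ua /gU Ub].
by have := UD _ _ Ua Ub; rewrite addrC subrK.
Qed.

Lemma supp_add_sub (U : set R) (f g : gps R) :
  supp f `<=` U -> supp g `<=` U -> supp (f + g) `<=` U.
Proof.
move=> fU gU mu H; have [f0|/fU //] := eqVneq (f mu) 0.
by apply: gU; move: H; rewrite /supp /= gcoefD f0 add0r.
Qed.

Lemma gweightM U l (f g : gps R) : additive_on U l -> supp f `<=` U -> supp g `<=` U ->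
  gweight l (f * g) = gweight l f * g + f * gweight l g.
Proof.
move=> [U0 UD lD] fU gU; apply: gpsP => mu; rewrite gcoefD !gcoefM /= gcoefM.
have [m Hm] := is_gps_lb (gcoefP g).
have [S [uS HS]] := is_gps_seq (mu - m + 1) (gcoefP f).
have inS a : f a != 0 -> g (mu - a) != 0 -> a \in S.
  by move=> fa /Hm ga; rewrite HS fa /=; lra.
rewrite (gps_mul_seq uS inS) (gps_mul_seq uS (f := fun nu => _ * f nu)); last first.
  by move=> a; rewrite mulf_eq0 negb_or => /andP[_]; apply: inS.
rewrite (gps_mul_seq uS (g := fun nu => _ * g nu)); last first.
  by move=> a fa; rewrite mulf_eq0 negb_or => /andP[_]; apply: inS.
rewrite mulr_sumr -big_split /=; apply: eq_bigr => a _.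
have [->|fa] := eqVneq (f a) 0; first by rewrite !(mul0r, mulr0) addr0.
have [->|ga] := eqVneq (g (mu - a)) 0; first by rewrite !(mul0r, mulr0) addr0.
have -> : l mu = l a + l (mu - a) by rewrite -lD ?[a + _]addrC ?subrK //; [exact: fU|exact: gU].
by ring.
Qed.

Lemma gweight_chain U l (v : 'I_k -> gps R) Q : additive_on U l ->
  (forall i, supp (v i) `<=` U) ->
  gweight l (gev v Q) = \sum_i gev v Q^`M(i) * gweight l (v i).
Proof.
move=> Ul vU; have l0 := additive_on0 Ul; have [U0 UD _] := Ul.
apply: (@mmap_chain_rule _ _ (@gconst R) k (fun f => supp f `<=` U)) => // [c|c|f g fU gU].
- by move=> mu; rewrite /supp /= gconstE; case: (mu =P 0) => [-> //|_]; rewrite eqxx.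
- by apply: gpsP => mu /=; rewrite gconstE; case: (mu =P 0) => [->|_]; rewrite ?l0 ?mul0r ?mulr0.
- split; [exact: supp_add_sub|exact: supp_mul_sub|exact: gweightD|exact: (gweightM Ul)].
Qed.

End Weights.

(** * The three operators in a common form *)

Section Operators.
Variable R : realType.
Local Notation C := R[i].
Local Notation gev := (mmap (@gconst R)).
Implicit Types (o : sigma_op R) (f : gps R).

(** The [j]-th iterate of each operator sends [x^mu] to [m_j(mu) x^(mu - e)], where [m_j] is a monic
    polynomial of degree [j] ([opM]) in the variable [mu] or [q^mu] ([opX]), and [e] is [j] for d/dx
    and 0 otherwise ([opshift]). Exponents can thus be counted as roots of polynomials. *)
Definition opX o (mu : R) : C :=
  match o with QDiffOp a t => qpow a t mu | _ => mu%:C end.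

Definition opM o (j : nat) : {poly C} :=
  match o with DerivOp => \prod_(i < j) ('X - (i%:R)%:P) | _ => 'X^j end.

Definition opshift o : R := match o with DerivOp => 1 | _ => 0 end.

Definition opw o j (mu : R) : C := (opM o j).[opX o mu].

Lemma op_iterE o j (s : R -> C) mu :
  op_iter o j s mu = opw o j (mu + opshift o * j%:R) * s (mu + opshift o * j%:R).
Proof.
rewrite /opw; elim: j mu => [|j IH] mu.
  rewrite mulr0 addr0 /=; case: o => [||a t] /=; rewrite ?big_ord0 ?expr0 ?hornerC ?mul1r //.
rewrite /op_iter iterS -/(op_iter o j s); case: o IH => [||a t] /= IH; rewrite IH.
- rewrite !mul1r mulrA -natr1 !addrA [mu + j%:R + 1]addrAC; congr (_ * _).
  rewrite big_ord_recr /= hornerM mulrC; congr (_ * _).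
  rewrite hornerXsubC; rewrite -(rmorph_nat (real_complex R)) -rmorphB; congr _%:C; ring.
- by rewrite !mul0r !addr0 !hornerXn exprS mulrA.
- by rewrite !mul0r !addr0 !hornerXn exprS mulrA.
Qed.

Lemma is_gps_op o j (s : R -> C) : is_gps s -> is_gps (op_iter o j s).
Proof.
move=> gs; have -> : op_iter o j s = fun mu =>
    opw o j (mu + opshift o * j%:R) * s (mu + opshift o * j%:R).
  by apply/funext => mu; rewrite op_iterE.
exact: (is_gps_shift (opshift o * j%:R) (is_gps_weight (opw o j) gs)).
Qed.

Definition gop o j f : gps R := Gps (is_gps_op o j (gcoefP f)).

Lemma gopE o j f mu :
  gop o j f mu = opw o j (mu + opshift o * j%:R) * f (mu + opshift o * j%:R).
Proof. exact: op_iterE. Qed.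

Lemma gopD o j f g : gop o j (f + g) = gop o j f + gop o j g.
Proof. by apply: gpsP => mu; rewrite gcoefD !gopE gcoefD mulrDr. Qed.

Definition gvars o n f (i : 'I_n.+2) : gps R :=
  if unlift ord0 i is Some j then gop o j f else gmono 1 1.

Lemma gvars0 o n f : gvars o f (ord0 : 'I_n.+2) = gmono 1 1.
Proof. by rewrite /gvars unlift_none. Qed.

Lemma gvarsS o n f (j : 'I_n.+1) : gvars o f (lift ord0 j) = gop o j f.
Proof. by rewrite /gvars liftK. Qed.

Lemma gmonoX m : (gmono 1 1 : gps R) ^+ m = gmono 1 m%:R.
Proof.
elim: m => [|m IH]; first by rewrite expr0.
by rewrite exprS IH gmonoM mulr1 nat1r.
Qed.

Lemma eval_diffE n (P : {mpoly C[n.+2]}) o f :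
  eval_diff P o f = gev (gvars o f) P :> (R -> C).
Proof.
rewrite /mmap /eval_diff (big_morph (@gcoef R) (id1 := @gps_zero R) (op1 := @gps_add R)) //.
apply: eq_bigr => m _; apply/funext => mu.
rewrite gcoef_constM /gps_scale; congr (_ * _); congr (_ mu).
rewrite /mmap1 [X in _ = gcoef X]big_ord_recl gvars0 gmonoX gcoefM; congr gps_mul.
rewrite (big_morph (@gcoef R) (id1 := @gps_one R) (op1 := @gps_mul R)) //.
apply: eq_bigr => i _; rewrite gvarsS.
elim: (m (lift ord0 i)) => [|d IH]; first by rewrite expr0.
by rewrite exprS gcoefM -IH.
Qed.

End Operators.

(** * Weighted l1 bounds *)

Section Modulus.
Variable R : realType.
Local Notation C := R[i].
Implicit Types (z : C).

Lemma normc_ge0 z : 0 <= Normc.normc z.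
Proof. by case: z => a b; exact: sqrtr_ge0. Qed.

Lemma normc_sum (I : eqType) (r : seq I) (F : I -> C) :
  Normc.normc (\sum_(i <- r) F i) <= \sum_(i <- r) Normc.normc (F i).
Proof.
elim: r => [|x r IH]; first by rewrite !big_nil Normc.normc0.
by rewrite !big_cons (le_trans (le_normcD _ _)) // lerD2l.
Qed.

Lemma sum_uniq_le (I : eqType) (S L : seq I) (F : I -> R) : uniq S -> uniq L ->
  (forall x, 0 <= F x) -> (forall x, x \in S -> x \notin L -> F x = 0) ->
  \sum_(x <- S) F x <= \sum_(x <- L) F x.
Proof.
move=> uS uL F0 FL; have -> : \sum_(x <- S) F x = \sum_(x <- S | x \in L) F x.
  rewrite [LHS](bigID (fun x => x \in L)) /= [X in _ + X]big1_seq ?addr0 // => x /andP[xL xS].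
  exact: FL.
have -> : \sum_(x <- S | x \in L) F x = \sum_(x <- L | x \in S) F x.
  rewrite -big_filter -[RHS]big_filter; apply: perm_big; apply: uniq_perm; rewrite ?filter_uniq //.
  by move=> x; rewrite !mem_filter andbC.
rewrite [leRHS](bigID (fun x => x \in S)) /= lerDl.
by apply: sumr_ge0.
Qed.

End Modulus.

Section Bounds.
Variable R : realType.
Local Notation C := R[i].
Local Notation normc := Normc.normc.
Implicit Types (f g h w : gps R) (r M a b : R).

Definition ord_ge a f := forall mu, f mu != 0 -> a <= mu.

(** Quantifying over finite lists replaces the weighted l1-norm of the part of [f] below [M]; a
    shift of exponents becomes a [map] on lists. *)
Definition bnd r M f (B : R) := forall S : seq R, uniq S -> (forall mu, mu \in S -> mu < M) ->
  \sum_(mu <- S) normc (f mu) * r `^ mu <= B.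

Definition fin_supp f := exists L : seq R, forall mu, f mu != 0 -> mu \in L.

Lemma ord_ge_le a b f : a <= b -> ord_ge b f -> ord_ge a f.
Proof. by move=> ab fb mu /fb; apply: le_trans. Qed.

Lemma ord_geD a f g : ord_ge a f -> ord_ge a g -> ord_ge a (f + g).
Proof.
move=> fa ga mu; rewrite gcoefD; have [->|/fa //] := eqVneq (f mu) 0.
by rewrite add0r; apply: ga.
Qed.

Lemma ord_geN a f : ord_ge a f -> ord_ge a (- f).
Proof. by move=> fa mu; rewrite gcoefN oppr_eq0; apply: fa. Qed.

Lemma ord_geM a b f g : ord_ge a f -> ord_ge b g -> ord_ge (a + b) (f * g).
Proof.
move=> fa gb mu; rewrite gcoefM => /gps_mul_supp[x /fa ax /gb bx]; lra.
Qed.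

Lemma ord_ge_sum a (I : Type) (s : seq I) (F : I -> gps R) :
  (forall i, ord_ge a (F i)) -> ord_ge a (\sum_(i <- s) F i).
Proof.
move=> Fa; apply: big_ind => // [mu|x y]; first by rewrite gcoef0 eqxx.
exact: ord_geD.
Qed.

Lemma ord_ge_mono (c : C) d : ord_ge d (gmono c d).
Proof. by move=> mu; rewrite gmonoE; case: (mu =P d) => [->|_]; rewrite ?eqxx. Qed.

Lemma fin_suppD f g : fin_supp f -> fin_supp g -> fin_supp (f + g).
Proof.
move=> [L HL] [L' HL']; exists (L ++ L') => mu; rewrite gcoefD mem_cat.
have [->|/HL -> //] := eqVneq (f mu) 0.
by rewrite add0r => /HL' ->; rewrite orbT.
Qed.

Lemma fin_suppM f g : fin_supp f -> fin_supp g -> fin_supp (f * g).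
Proof.
move=> [L HL] [L' HL']; exists [seq x + y | x <- L, y <- L'] => mu.
rewrite gcoefM => /gps_mul_supp[x /HL xL /HL' yL]; apply/allpairsP.
by exists (x, mu - x); split => //=; rewrite [x + _]addrC subrK.
Qed.

Lemma fin_supp_mono c d : fin_supp (gmono c d : gps R).
Proof.
exists [:: d] => mu; rewrite gmonoE inE.
by case: (mu =P d) => //; rewrite eqxx.
Qed.

Lemma fin_supp_mmap k (Y : 'I_k -> gps R) (Q : {mpoly C[k]}) :
  (forall i, fin_supp (Y i)) -> fin_supp (mmap (@gconst R) Y Q).
Proof.
move=> FY; elim/mpoly_ring_ind: Q => [c|j|p q Hp Hq|p q Hp Hq].
- by rewrite mmapC; exact: fin_supp_mono.
- by rewrite mmapX mmap1U.
- by rewrite mmapD; apply: fin_suppD.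
- by rewrite rmorphM; apply: fin_suppM.
Qed.

(** Submultiplicativity of the weighted l1-norm. The cut-offs match because [x >= a], [y >= b] and
    [x + y < M + (a + b)] force [x < M + a] and [y < M + b]. *)
Lemma bnd_mul r M a b f g B1 B2 : 0 < r -> 0 <= B2 -> ord_ge a f -> ord_ge b g ->
  bnd r (M + a) f B1 -> bnd r (M + b) g B2 -> bnd r (M + (a + b)) (f * g) (B1 * B2).
Proof.
move=> r0 B20 fa gb fB gB S uS SM.
have [F [uF HF]] := is_gps_seq (M + a) (gcoefP f).
have FaM x : x \in F -> a <= x < M + a by rewrite HF => /andP[/fa -> ->].
apply: (@le_trans _ _ (\sum_(mu <- S) \sum_(x <- F)
    (normc (f x) * r `^ x) * (normc (g (mu - x)) * r `^ (mu - x)))).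
  rewrite big_seq [leRHS]big_seq; apply: ler_sum => mu muS.
  rewrite gcoefM (gps_mul_seq_lt uF HF gb); last by have := SM _ muS; lra.
  apply: le_trans (ler_wpM2r (powR_ge0 _ _) (normc_sum _ _)) _.
  rewrite mulr_suml; apply: ler_sum => x _.
  rewrite Normc.normcM [in leRHS]mulrACA -powRD; last by rewrite (gt_eqF r0) implybT.
  by rewrite [x + _]addrC subrK.
rewrite exchange_big /=.
apply: (@le_trans _ _ (\sum_(x <- F) normc (f x) * r `^ x * B2)).
  rewrite big_seq [leRHS]big_seq; apply: ler_sum => x xF.
  rewrite -mulr_sumr ler_wpM2l ?mulr_ge0 ?normc_ge0 ?powR_ge0 //.
  have := gB [seq mu - x | mu <- S]; rewrite big_map; apply.
    by rewrite map_inj_uniq //; exact: addIr.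
  move=> y /mapP[mu muS ->]; have := SM _ muS; have /andP[]:= FaM _ xF; lra.
rewrite -mulr_suml ler_wpM2r //; apply: fB => // x /FaM /andP[_ //].
Qed.

Lemma bnd_le r M M' f B B' : M' <= M -> B <= B' -> bnd r M f B -> bnd r M' f B'.
Proof.
move=> MM BB fB S uS SM; apply: le_trans BB; apply: fB => // mu /SM.
by move=> /lt_le_trans; apply.
Qed.

Section Good.
Variables (w : gps R) (K : R).

(* [good a f]: whenever the part of [w] below [M + K] is small in the weighted
   l1-norm of radius [r], so is the part of [f] below [M + a], with a bound
   uniform in [r] and [M]. *)
Definition good a f := ord_ge a f /\ exists2 B, 0 <= B & forall r M, 0 < r <= 1 ->
  bnd r (M + K) w (r `^ K) -> bnd r (M + a) f (B * r `^ a).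

(** Since [r <= 1], [r^mu <= r^a] on the support, so the l1-norm of [f] is a constant valid for all
    [r] and [M]. *)
Lemma good_fin a f : fin_supp f -> ord_ge a f -> good a f.
Proof.
move=> [L HL] fa; split=> //; exists (\sum_(mu <- undup L) normc (f mu)).
  by apply: sumr_ge0 => mu _; exact: normc_ge0.
move=> r M r01 _ S uS _; apply: (@le_trans _ _ (\sum_(mu <- S) normc (f mu) * r `^ a)).
  apply: ler_sum => mu _; have [->|/fa amu] := eqVneq (f mu) 0.
    by rewrite Normc.normc0 !mul0r.
  by rewrite ler_wpM2l ?normc_ge0 //; apply: ger_powR.
rewrite -mulr_suml ler_wpM2r ?powR_ge0 //; apply: sum_uniq_le; rewrite ?undup_uniq //.
  by move=> mu; exact: normc_ge0.
move=> mu _; rewrite mem_undup; have [->|/HL -> //] := eqVneq (f mu) 0.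
by rewrite Normc.normc0.
Qed.

Lemma good_filtration : filtration (@gconst R) good.
Proof.
split.
- move=> a b f ab [fb [B B0 H]]; split; first exact: ord_ge_le fb.
  exists B => // r M r01 /(H _ _ r01); apply: bnd_le; first by rewrite lerD2l.
  by rewrite ler_wpM2l //; apply: ger_powR.
- by move=> a; apply: good_fin; [exists [::] => mu|move=> mu]; rewrite gcoef0 eqxx.
- by move=> c; apply: good_fin; [exact: fin_supp_mono|exact: ord_ge_mono].
- move=> a f g [fa [B B0 H]] [ga [B' B'0 H']]; split; first exact: ord_geD.
  exists (B + B'); first exact: addr_ge0.
  move=> r M r01 wr S uS SM.
  have := lerD (H r M r01 wr S uS SM) (H' r M r01 wr S uS SM).
  rewrite -mulrDl; apply: le_trans; rewrite -big_split; apply: ler_sum => mu _ /=.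
  by rewrite gcoefD -mulrDl ler_wpM2r ?powR_ge0 // le_normcD.
- move=> a b f g [fa [B B0 H]] [gb [B' B'0 H']]; split; first exact: ord_geM.
  exists (B * B'); first exact: mulr_ge0.
  move=> r M r01 wr; have /andP[r0 _] := r01.
  rewrite powRD ?(gt_eqF r0) ?implybT // mulrACA.
  by apply: bnd_mul => //; rewrite ?mulr_ge0 ?powR_ge0 //; [exact: H|exact: H'].
Qed.

End Good.
End Bounds.

(** * Convergence of the tail by majorants *)

Section Majorant.
Variables (R : realType) (o : sigma_op R) (n : nat) (Q : {mpoly R[i][n.+2]}) (f : gps R).
Local Notation C := R[i].
Local Notation normc := Normc.normc.
Local Notation gev := (mmap (@gconst R)).
Local Notation e j := (opshift o * j%:R).

Lemma opshift_bound (j : 'I_n.+1) : 0 <= e j <= n%:R.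
Proof.
have jn : 0 <= (j%:R : R) <= n%:R by rewrite ler0n ler_nat -ltnS ltn_ord.
by case: o => [||a t] /=; rewrite ?mul1r // mul0r lexx ler0n.
Qed.

Lemma opw0 mu : opw o 0 mu = 1.
Proof. by rewrite /opw; case: o => [||a t] /=; rewrite ?big_ord0 ?expr0 hornerC. Qed.

Lemma gop_ord_ge j a (g : gps R) : ord_ge a g -> ord_ge (a - e j) (gop o j g).
Proof.
move=> ga mu; rewrite gopE mulf_eq0 negb_or => /andP[_ /ga]; lra.
Qed.

Lemma gop_fin_supp j (g : gps R) : fin_supp g -> fin_supp (gop o j g).
Proof.
move=> [L HL]; exists [seq x - e j | x <- L] => mu.
rewrite gopE mulf_eq0 negb_or => /andP[_ /HL muL]; apply/mapP; exists (mu + e j) => //.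
by rewrite addrK.
Qed.

(** The operator with leading coefficients [phi j * x^(nu + e j)] sends [x^mu] to
    [indicial phi mu * x^(nu + mu)]. *)
Definition indicial (phi : 'I_n.+1 -> C) (mu : R) : C := \sum_j phi j * opw o j mu.

(** This is where regularity of the singularity enters: a bound on [Phi(mu) u_mu] controls every
    derivative of [u], at no cost beyond the shift of exponents. *)
Lemma good_gop phi (u : gps R) (K B : R) (j : 'I_n.+1) :
  0 <= B -> ord_ge K u ->
  (forall mu, K <= mu -> normc (opw o j mu) <= B * normc (indicial phi mu)) ->
  good (gweight (indicial phi) u) K (K - e j) (gop o j u).
Proof.
move=> B0 uK HB; split; first exact: gop_ord_ge.
exists B => // r M /andP[r0 r1] wr S uS SM.
have rD x y : r `^ (x + y) = r `^ x * r `^ y by rewrite powRD // (gt_eqF r0) implybT.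
have uS' : uniq [seq mu + e j | mu <- S] by rewrite map_inj_uniq //; exact: addIr.
have SM' mu : mu \in [seq mu + e j | mu <- S] -> mu < M + K.
  by move=> /mapP[x xS ->]; have := SM _ xS; lra.
have := wr _ uS' SM'; rewrite big_map => H; have H' : r `^ (- e j) * (B * \sum_(mu <- S)
    normc (gweight (indicial phi) u (mu + e j)) * r `^ (mu + e j)) <= B * r `^ (K - e j).
  have -> : B * r `^ (K - e j) = r `^ (- e j) * (B * r `^ K) by rewrite rD; ring.
  by rewrite ler_wpM2l ?powR_ge0 // ler_wpM2l.
apply: le_trans H'; rewrite !mulr_sumr; apply: ler_sum => mu _.
rewrite gopE /= !Normc.normcM rD powRN.
have [->|/uK/HB H1] := eqVneq (u (mu + e j)) 0; first by rewrite Normc.normc0 !(mulr0, mul0r).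
have -> : (r `^ e j)^-1 * (B * (normc (indicial phi (mu + e j)) * normc (u (mu + e j)) * (r `^ mu * r `^ e j)))
   = (B * normc (indicial phi (mu + e j))) * normc (u (mu + e j)) * r `^ mu.
  by have := gt_eqF (powR_gt0 (e j) r0) => /negbT; move: (r `^ e j) => x x0; field.
by rewrite ler_wpM2r ?powR_ge0 // ler_wpM2r // normc_ge0.
Qed.

Lemma powR_small (B d : R) : 0 <= B -> 0 < d -> exists2 r, 0 < r <= 1 & B * r `^ d <= 1.
Proof.
move=> B0 d0; have B1 : 0 < B + 1 by lra.
have i01 : 0 < (B + 1)^-1 <= 1 by rewrite invr_gt0 B1 invf_le1 //; lra.
exists ((B + 1)^-1 `^ d^-1).
  have /andP[i0 _] := i01; rewrite powR_gt0 //= -[leRHS](powRr0 (B + 1)^-1).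
  by apply: ger_powR => //; rewrite invr_ge0 ltW.
rewrite -powRrM mulVf ?gt_eqF // powRr1; last by case/andP: i01 => /ltW.
by rewrite ler_pdivrMr //; lra.
Qed.

Lemma majorant (nu d mu1 B : R) (phi : 'I_n.+1 -> C) :
  gev (gvars o f) Q = 0 -> 0 < d <= 1 -> 0 <= B ->
  (forall j : 'I_n.+1, ord_ge (nu + e j + d)
     (gev (gvars o f) Q^`M(lift ord0 j) - gmono (phi j) (nu + e j))) ->
  (forall (j : 'I_n.+1) mu, mu1 <= mu -> normc (opw o j mu) <= B * normc (indicial phi mu)) ->
  exists r K D : R, [/\ 0 < r, 0 <= K & forall S : seq R, uniq S ->
    (forall mu, mu \in S -> K <= mu) ->
    \sum_(mu <- S) normc (f mu) * r `^ mu <= D].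
Proof.
move=> Q0 /andP[d0 d1] B0 Hlead HB.
have [m Hm] := is_gps_lb (gcoefP f).
(* All of [x, p, p', ..., p^(n)] have order at least [-b]: differentiation lowers the order [m] by
   at most [n]. *)
pose b : R := `|m| + n%:R.
have b0 : 0 <= b by rewrite addr_ge0 // ler0n.
have [B1 HB1] := filtration_taylor (@gconst R) Q b0.
pose incr_good (j : 'I_n.+1) (B2 : R) := forall F, filtration (@gconst R) F ->
  forall K : R, 0 <= K -> forall Y T,
    (forall i, F (- b) (Y i)) -> (forall i, F (K - b) (T i)) ->
    F (K - B2) (gev (fun i => Y i + T i) Q^`M(lift ord0 j) - gev Y Q^`M(lift ord0 j)).
have [B2 HB2] : exists B2, forall j, incr_good j (B2 j).
  apply: (@fin_all_exists _ (fun=> R) incr_good) => j.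
  have [B2 HB2] := filtration_taylor (@gconst R) Q^`M(lift ord0 j) b0.
  by exists B2 => F HF K K0 Y T FY FT; have [] := HB2 F HF K K0 Y T FY FT.
(* Large enough for three purposes: the domination [HB] holds from [K] on ([K1]), the coefficients
   at [p] and at [f] have the same leading terms ([K2]), and the quadratic remainder lies beyond
   order [nu + K + d] ([K3]). *)
pose K : R := `|mu1| + `|nu| + n%:R + 1 + `|B1| + \sum_j `|B2 j|.
have n0 : 0 <= (n%:R : R) by rewrite ler0n.
have sB : 0 <= \sum_j `|B2 j| by apply: sumr_ge0.
have sBj j : B2 j <= \sum_j `|B2 j|.
  rewrite (bigD1 j) //=; apply: le_trans (ler_norm _) _.
  by rewrite lerDl; apply: sumr_ge0.
have := ler_norm mu1; have := ler_norm nu; have := ler_norm B1.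
have := normr_ge0 mu1; have := normr_ge0 nu; have := normr_ge0 B1 => a1 a2 a3 a4 a5 a6.
have K0 : 0 <= K by rewrite /K; lra.
have K1 : mu1 <= K by rewrite /K; lra.
have K2 (j : 'I_n.+1) : nu + e j + d <= K - B2 j.
  by have := sBj j; have /andP[_] := opshift_bound j; rewrite /K; lra.
have K3 : nu + K + d <= 2 * K - B1 by rewrite /K; lra.
(* Cutting at [K + 1] instead of [K] leaves a margin of 1, at least [d], so that the linear terms in
   [u] have order at least [nu + K + d]. *)
pose p := gweight (fun mu => if mu < K + 1 then 1 else 0) f.
pose u := gweight (fun mu => if mu < K + 1 then 0 else 1) f.
have fE : f = p + u.
  by apply: gpsP => mu; rewrite gcoefD /=; case: ifP; rewrite mul1r mul0r ?addr0 ?add0r.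
have uK1 : ord_ge (K + 1) u.
  by move=> mu /=; case: ltP => //; rewrite mul0r eqxx.
have uK : ord_ge K u by apply: ord_ge_le uK1; lra.
have pfin : fin_supp p.
  have [L [_ HL]] := is_gps_seq (K + 1) (gcoefP f); exists L => mu /=.
  by rewrite HL; case: ltP; rewrite ?mul0r ?eqxx // mul1r => _ ->.
have pm : ord_ge m p.
  by move=> mu /=; rewrite mulf_eq0 negb_or => /andP[_ /Hm].
pose w := gweight (indicial phi) u.
have GF := good_filtration w K.
have Tj (j : 'I_n.+1) : good w K (K - e j) (gop o j u).
  by apply: (good_gop B0) => // mu Kmu; apply: HB; lra.
pose Y := gvars (n := n) o p.
pose T (i : 'I_n.+2) : gps R := if unlift ord0 i is Some j then gop o j u else 0.
have TS (j : 'I_n.+1) : T (lift ord0 j) = gop o j u by rewrite /T liftK.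
have YT : (fun i => Y i + T i) = gvars o f.
  apply/funext => i; rewrite /Y /T /gvars.
  by case: (unlift ord0 i) => [j|]; rewrite ?addr0 // -gopD -fE.
have Yfin i : fin_supp (Y i).
  rewrite /Y /gvars; case: (unlift ord0 i) => [j|]; last exact: fin_supp_mono.
  exact: gop_fin_supp.
have GY i : good w K (- b) (Y i).
  apply: good_fin => //; rewrite /Y /gvars; case: (unlift ord0 i) => [j|].
    apply: (@ord_ge_le _ _ (m - e j)); last exact: gop_ord_ge.
    have /andP[_] := opshift_bound j; have := ler_norm (- m); rewrite normrN /b; lra.
  by apply: ord_ge_le (@ord_ge_mono R 1 1); lra.
have GT i : good w K (K - b) (T i).
  rewrite /T; case: (unlift ord0 i) => [j|]; last exact: (filt_0 GF).
  apply: (filt_le GF) (Tj j); have /andP[_] := opshift_bound j.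
  by have := normr_ge0 m; rewrite /b; lra.
pose a (j : 'I_n.+1) := gev Y Q^`M(lift ord0 j).
have afin j : fin_supp (a j) by apply: fin_supp_mmap.
have alead (j : 'I_n.+1) : ord_ge (nu + e j + d) (a j - gmono (phi j) (nu + e j)).
  have [Hd _] := HB2 j _ GF K K0 Y T GY GT.
  have -> : a j - gmono (phi j) (nu + e j) =
    (gev (gvars o f) Q^`M(lift ord0 j) - gmono (phi j) (nu + e j)) -
    (gev (fun i => Y i + T i) Q^`M(lift ord0 j) - gev Y Q^`M(lift ord0 j)).
    by rewrite YT -/(a j) opprB [RHS]addrC addrA subrK.
  by apply: ord_geD => //; apply: ord_geN; apply: ord_ge_le Hd.
have agood (j : 'I_n.+1) : good w K (nu + e j + d) (a j - gmono (phi j) (nu + e j)).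
  apply: good_fin => //; apply: fin_suppD => //.
  have -> : - gmono (phi j) (nu + e j) = gmono (- phi j) (nu + e j) :> gps R.
    by apply: gpsP => mu; rewrite gcoefN !gmonoE; case: ifP; rewrite ?oppr0.
  exact: fin_supp_mono.
have aord (j : 'I_n.+1) : ord_ge (nu + e j) (a j).
  rewrite -[a j](subrK (gmono (phi j) (nu + e j))); apply: ord_geD; last exact: ord_ge_mono.
  by apply: ord_ge_le (alead j); lra.
have T0 : T ord0 = 0 by rewrite /T unlift_none.
have dQ : \sum_i gev Y Q^`M(i) * T i = \sum_j a j * gop o j u.
  rewrite big_ord_recl T0 mulr0 add0r; apply: eq_bigr => j _.
  by rewrite TS.
have [_ _] := HB1 _ GF K K0 Y T GY GT; rewrite YT Q0 sub0r dQ.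
set R0 : gps R := (- _ - _) => GR0.
have gE : gev Y Q = - R0 - \sum_j a j * gop o j u by rewrite /R0 opprB opprK addrAC subrr add0r.
(* [gev Y Q] has finite support, so only its order is at stake, and the equation expresses it
   through terms of high order. *)
have Gg : good w K (nu + K + d) (gev Y Q).
  apply: good_fin; first exact: fin_supp_mmap.
  rewrite gE; apply: ord_geD; apply: ord_geN; first by apply: ord_ge_le K3 _; case: GR0.
  apply: ord_ge_sum => j; apply: (@ord_ge_le _ _ (nu + e j + (K + 1 - e j))); first by lra.
  by apply: ord_geM => //; apply: gop_ord_ge.
(* The leading part of the linearized operator applied to [u]. It is [w] shifted by [nu], yet the
   equation places it in degree [nu + K + d]; this gain of [d] drives the induction. *)
pose h := \sum_j gmono (phi j) (nu + e j) * gop o j u.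
have hE : h = - R0 - gev Y Q - \sum_j (a j - gmono (phi j) (nu + e j)) * gop o j u.
  rewrite gE; move: R0 {GR0 gE} => x; rewrite opprB opprK addrCA addNr addr0.
  by rewrite -sumrB; apply: eq_bigr => j _; rewrite -mulrBl subKr.
have [hord [D D0 HD]] : good w K (nu + K + d) h.
  rewrite hE; apply: (filt_sub GF); first apply: (filt_sub GF) => //.
    by apply: (filt_opp GF); apply: (filt_le GF) GR0.
  have Gj j : good w K (nu + K + d) ((a j - gmono (phi j) (nu + e j)) * gop o j u).
    by apply: (filt_le GF) (filt_mul GF (agood j) (Tj j)); lra.
  exact: (filt_sum _ GF Gj).
have hcoef mu : h (nu + mu) = w mu.
  rewrite gcoef_sum /= /indicial mulr_suml; apply: eq_bigr => j _.
  rewrite gcoef_monoM gopE /= mulrA.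
  by have -> : nu + mu - (nu + e j) + e j = mu by ring.
have [r r01 rD] := powR_small D0 d0; have /andP[r0 r1] := r01.
have rDE x y : r `^ (x + y) = r `^ x * r `^ y by rewrite powRD // (gt_eqF r0) implybT.
(* The bound below [k * d + K] controls [h] below [k * d + (nu + K + d)], hence [w] one step [d]
   further, with the factor [D * r^d <= 1]. At [k = 0] nothing is to be bounded, since [w] vanishes
   below [K]. *)
have wbnd k : bnd r (k%:R * d + K) w (r `^ K).
  elim: k => [|k IH] S uS SM.
    rewrite big1_seq ?powR_ge0 // => mu /andP[_ /SM]; rewrite mul0r add0r => muK.
    have -> : w mu = 0; last by rewrite Normc.normc0 mul0r.
    by rewrite /= (lt_trans muK) ?ltrDl // mul0r mulr0.
  have uS' : uniq [seq nu + mu | mu <- S] by rewrite map_inj_uniq //; exact: addrI.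
  have SM' mu : mu \in [seq nu + mu | mu <- S] -> mu < k%:R * d + (nu + K + d).
    by move=> /mapP[x xS ->]; have := SM _ xS; rewrite -natr1 mulrDl; lra.
  have := HD r _ r01 IH _ uS' SM'; rewrite big_map.
  under eq_bigr do rewrite hcoef rDE mulrCA.
  rewrite -mulr_sumr -addrA rDE mulrCA ler_pM2l ?powR_gt0 // rDE => H.
  apply: le_trans H _; rewrite mulrCA; rewrite -[leRHS]mulr1.
  by rewrite ler_wpM2l ?powR_ge0.
exists r, (K + 1), (B * r `^ K); split=> // [|S uS SK]; first by lra.
have [M HM] : exists M, forall mu, mu \in S -> mu < M.
  elim: S {uS SK} => [|x S [M HM]]; first by exists 0.
  exists (Order.max (x + 1) M) => y; rewrite inE lt_max => /predU1P[->|/HM ->]; rewrite ?orbT //.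
  by rewrite ltrDl ltr01.
have [k Hk] : exists k : nat, M <= k%:R * d + K.
  exists (Num.bound (`|M| / d)); have := archi_boundP (divr_ge0 (normr_ge0 M) (ltW d0)).
  by rewrite ltr_pdivrMr // => /ltW H; have := ler_norm M; lra.
have := wbnd k S uS (fun mu muS => lt_le_trans (HM mu muS) Hk) => H.
apply: le_trans (ler_wpM2l B0 H); rewrite mulr_sumr.
rewrite big_seq [leRHS]big_seq; apply: ler_sum => mu muS; rewrite mulrA ler_wpM2r ?powR_ge0 //.
have Kmu := SK _ muS; rewrite /= ltNge Kmu /= mul1r Normc.normcM mulrA.
rewrite -[leLHS]mul1r ler_wpM2r ?normc_ge0 //.
(* The multiplier of [s] itself is 1, so the domination for [j = 0] gives [1 <= B * |Phi(mu)|]. *)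
have := HB ord0 mu; rewrite opw0 Normc.normc1; apply; lra.
Qed.

End Majorant.

(** * Growth of the indicial polynomial *)

Section IndicialGrowth.
Variables (R : realType) (o : sigma_op R) (n : nat).
Local Notation C := R[i].
Local Notation normc := Normc.normc.
Hypothesis oP : op_ok o.
Implicit Types (phi : 'I_n.+1 -> C).

Lemma normc_real (x : R) : normc x%:C = `|x|.
Proof. by rewrite /= expr0n /= addr0 sqrtr_sqr. Qed.

Lemma normc_cis (t : R) : normc (cis t) = 1.
Proof. by rewrite /cis /= cos2Dsin2 sqrtr1. Qed.

Lemma normc_qpow (a t mu : R) : normc (qpow a t mu) = a `^ mu.
Proof. by rewrite /qpow Normc.normcM normc_cis mulr1 normc_real ger0_norm ?powR_ge0. Qed.

Lemma normc_eq0 (z : C) : (normc z == 0) = (z == 0).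
Proof.
apply/eqP/eqP => [|->]; first exact: Normc.eq0_normc.
exact: Normc.normc0.
Qed.

Lemma normc_gt0 (z : C) : (0 < normc z) = (z != 0).
Proof. by rewrite lt_neqAle normc_ge0 andbT eq_sym normc_eq0. Qed.

Lemma normc_prod (I : Type) (r : seq I) (F : I -> C) :
  normc (\prod_(i <- r) F i) = \prod_(i <- r) normc (F i).
Proof. exact: (big_morph _ (@Normc.normcM R) (Normc.normc1 R)). Qed.

Lemma normcX (z : C) k : normc (z ^+ k) = normc z ^+ k.
Proof. by elim: k => [|k IH]; rewrite ?expr0 ?Normc.normc1 // !exprS Normc.normcM IH. Qed.

Lemma normcB_ge (x y : C) : normc x - normc y <= normc (x - y).
Proof. by rewrite lerBlDr -{1}[x](subrK y); exact: le_normcD. Qed.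

Lemma normcB_le (x y : C) : normc (x - y) <= normc x + normc y.
Proof. by apply: le_trans (le_normcD _ _) _; rewrite normcN. Qed.

(** For the q-difference operator the modulus [a^mu] already determines [mu], as [a != 1]. Distinct
    exponents thus give distinct roots. *)
Lemma opX_inj : injective (opX o).
Proof.
move=> x y; case: o oP => [_|_|a t [a0 a1]] /=; try exact: complexI.
move=> /(congr1 (@Normc.normc R)); rewrite !normc_qpow /powR gt_eqF // => /expR_inj.
apply: mulIf; apply/eqP => la0; move/eqP: a1; apply.
by apply: ln_inj; rewrite ?posrE // la0 ln1.
Qed.

Lemma opM_monic j : opM o j \is monic.
Proof. by case: o => [||a t] /=; rewrite ?monicXn // monic_prod_XsubC. Qed.

Lemma size_opM j : size (opM o j) = j.+1.
Proof.
by case: o => [||a t] /=; rewrite ?size_polyXn // size_prod_XsubC /index_enum -enumT size_enum_ord.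
Qed.

Definition indicial_poly phi : {poly C} := \sum_j phi j *: opM o j.

Lemma indicialE phi mu : indicial o phi mu = (indicial_poly phi).[opX o mu].
Proof. by rewrite horner_sum; apply: eq_bigr => j _; rewrite hornerZ. Qed.

Lemma size_indicial_poly phi : (size (indicial_poly phi) <= n.+1)%N.
Proof.
apply: leq_trans (size_sum _ _ _) _; apply/bigmax_leqP => j _.
by rewrite (leq_trans (size_scale_leq _ _)) // size_opM.
Qed.

(** As [opM j] has degree exactly [j], the largest [j] with [phi j != 0] contributes a leading
    coefficient that nothing cancels. *)
Lemma indicial_poly_neq0 phi j0 : phi j0 != 0 -> indicial_poly phi != 0.
Proof.
move=> nz; case: (@arg_maxnP _ j0 [pred j | phi j != 0] (fun j : 'I_n.+1 => j : nat) nz) => j /= pj jmax.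
apply/eqP => /(congr1 (fun p : {poly C} => p`_j)); rewrite coef0 coef_sum.
rewrite (bigD1 j) //= big1 => [|i ij].
  rewrite coefZ addr0; have /monicP := opM_monic j; rewrite lead_coefE size_opM /= => ->.
  by rewrite mulr1 => /eqP; exact/negP.
rewrite coefZ; have [->|pi] := eqVneq (phi i) 0; first by rewrite mul0r.
rewrite nth_default ?mulr0 // size_opM ltn_neqAle jmax // andbT.
by apply: contraNneq ij => /val_inj ->.
Qed.

Lemma opX_large : (forall a t, o = QDiffOp a t -> 1 < a) ->
  forall A : R, exists mu1, forall mu, mu1 <= mu -> A <= normc (opX o mu).
Proof.
move=> Ha A; case: o oP Ha => [_ _|_ _|a t [a0 _] /(_ a t erefl) a1]; rewrite /opX.
- by exists A => mu Amu; rewrite normc_real (le_trans Amu) // ler_norm.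
- by exists A => mu Amu; rewrite normc_real (le_trans Amu) // ler_norm.
have la : 0 < ln a by rewrite ln_gt0.
exists (ln (`|A| + 1) / ln a) => mu; rewrite ler_pdivrMr // => H.
have A1 : 0 < `|A| + 1 by rewrite ltr_wpDl.
rewrite normc_qpow /powR gt_eqF //.
apply: (@le_trans _ _ (sequences.expR (ln (`|A| + 1)))); last by rewrite ler_expR.
by rewrite lnK ?posrE // (le_trans (ler_norm A)) // lerDl.
Qed.

Lemma opX_small a t : o = QDiffOp a t -> a < 1 ->
  forall A : R, 0 < A -> exists mu1, forall mu, mu1 <= mu -> normc (opX o mu) <= A.
Proof.
move=> oE a1 A A0; have := oP; rewrite oE => -[a0 _].
have la : ln a < 0 by rewrite ln_lt0 // a0.
exists (ln A / ln a) => mu; rewrite ler_ndivrMr // => H.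
by rewrite /opX normc_qpow /powR gt_eqF // -[leRHS]lnK ?posrE // ler_expR.
Qed.

Lemma opM_bound (j : 'I_n.+1) (x : C) : 1 <= normc x ->
  normc (opM o j).[x] <= (n.+1%:R * normc x) ^+ n.
Proof.
move=> x1; set Y := n.+1%:R * normc x.
have xY : normc x <= Y by rewrite /Y -[leLHS]mul1r ler_wpM2r ?normc_ge0 // ler1n.
have Y1 : 1 <= Y by apply: le_trans xY.
have jn : (j <= n)%N by rewrite -ltnS.
apply: (@le_trans _ _ (Y ^+ j)); last by rewrite ler_weXn2l.
have HX : normc ('X^j).[x] <= Y ^+ j.
  by rewrite hornerXn normcX lerXn2r // nnegrE ?normc_ge0 // (le_trans _ Y1).
case: o => [||a t] //=.
rewrite -(big_mkord xpredT (fun i => 'X - (i%:R)%:P)) horner_prod normc_prod big_mkord.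
have -> : Y ^+ j = \prod_(i < j) Y by rewrite prodr_const card_ord.
apply: ler_prod => i _; rewrite normc_ge0 hornerXsubC /=.
apply: le_trans (normcB_le _ _) _.
have -> : (i%:R : C) = (i%:R)%:C by rewrite rmorph_nat.
rewrite normc_real ger0_norm ?ler0n // /Y.
have ij : (i%:R : R) <= n%:R by rewrite ler_nat (leq_trans _ jn) // ltnW.
rewrite -nat1r mulrDl mul1r lerD2l; apply: le_trans ij _.
by rewrite -[leLHS]mulr1 ler_wpM2l // ler0n.
Qed.

(** Having [n] distinct roots and degree at most [n], the polynomial is a nonzero constant times the
    product of the [x - z]. When [|x|] tends to infinity this is of the size of [|x|^n], which
    bounds every [m_j]. *)
Lemma indicial_growth phi j0 (rs : seq R) : phi j0 != 0 -> uniq rs -> size rs = n ->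
  (forall mu, mu \in rs -> indicial o phi mu = 0) ->
  exists B mu1 : R, 0 <= B /\ forall (j : 'I_n.+1) mu, mu1 <= mu ->
    normc (opw o j mu) <= B * normc (indicial o phi mu).
Proof.
move=> nz uS sz Hrs; pose p := indicial_poly phi; pose zs := map (opX o) rs.
have uzs : uniq zs by rewrite map_inj_uniq //; exact: opX_inj.
have p0 : p != 0 by apply: indicial_poly_neq0 nz.
have rzs : all (root p) zs.
  by apply/allP => _ /mapP[mu /Hrs muS ->]; rewrite /root -indicialE muS.
have szp : size p = (size zs).+1.
  apply/eqP; rewrite eqn_leq (max_poly_roots p0 rzs uzs) andbT.
  by rewrite size_map sz size_indicial_poly.
have pE := all_roots_prod_XsubC szp rzs; rewrite uniq_rootsE in pE.
have {}pE x : normc p.[x] = normc (lead_coef p) * \prod_(z <- zs) normc (x - z).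
  rewrite (pE uzs) lead_coefZ (monicP (monic_prod_XsubC _ _ _)) mulr1 hornerZ Normc.normcM horner_prod normc_prod.
  by congr (_ * _); apply: eq_bigr => z _; rewrite hornerXsubC.
have l0 : 0 < normc (lead_coef p) by rewrite normc_gt0 lead_coef_eq0.
have szs : size zs = n by rewrite size_map.
have [Hlarge|] := pselect (forall a t, o = QDiffOp a t -> 1 < a).
  (* The threshold gives [|x| >= 1] and [|x| >= 2 |z|] for every root, hence
     [|x - z| >= |x| / 2]. *)
  have [mu1 Hmu1] := opX_large Hlarge (1 + 2 * \sum_(z <- zs) normc z).
  exists ((2 * n.+1%:R) ^+ n / normc (lead_coef p)), mu1; split.
    by rewrite divr_ge0 ?normc_ge0 // exprn_ge0 // mulr_ge0 ?ler0n.
  move=> j mu /Hmu1; rewrite indicialE -/p pE /opw; move: (opX o mu) => x xl.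
  have sz0 : 0 <= \sum_(z <- zs) normc z by apply: sumr_ge0 => z _; exact: normc_ge0.
  have x1 : 1 <= normc x by lra.
  apply: le_trans (opM_bound j x1) _.
  rewrite [(2 * _) ^+ n]exprMn [X in X <= _]exprMn.
  have regroup (N T L P : R) : 0 < L -> T * N / L * (L * P) = N * (T * P).
    by move=> L0; field; rewrite gt_eqF.
  rewrite regroup // ler_wpM2l ?exprn_ge0 ?ler0n //.
  have -> : normc x ^+ n = 2 ^+ n * \prod_(z <- zs) (normc x / 2).
    by rewrite big_const_seq count_predT iter_mulr_1 szs -exprMn [2 * _]mulrC divfK ?pnatr_eq0.
  rewrite ler_wpM2l ?exprn_ge0 // big_seq [leRHS]big_seq.
  apply: ler_prod => z zzs; rewrite divr_ge0 ?normc_ge0 //=.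
  have zl : normc z <= \sum_(z <- zs) normc z.
    by rewrite (big_rem z) //= lerDl; apply: sumr_ge0 => y _; exact: normc_ge0.
  apply: le_trans (normcB_ge x z); lra.
(* For [|q| < 1] the variable [q^mu] tends to 0, and the indicial polynomial
   does not vanish there because its [n] roots are powers of [q]. *)
move=> /existsNP[a /existsNP[t /not_implyP[oE /negP]]]; rewrite -leNgt => a1.
have a1' : a < 1.
  by rewrite lt_neqAle a1 andbT; have := oP; rewrite oE => -[].
have zs0 z : z \in zs -> 0 < normc z.
  move=> /mapP[mu _ ->]; rewrite oE /opX normc_qpow powR_gt0 //.
  by have := oP; rewrite oE => -[].
(* For [|x| <= A] every factor satisfies [|x - z| >= A], while [A <= 1] bounds the powers of [x] by
   1. *)
have [A /andP[A0 A1] HA] : exists2 A : R, 0 < A <= 1 & forall z, z \in zs -> 2 * A <= normc z.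
  elim: (zs) zs0 => [|z s IH] H; first by exists 1; rewrite ?ltr01 ?lexx.
  have [|A /andP[A0 A1] HA] := IH; first by move=> y ys; apply: H; rewrite inE ys orbT.
  have z0 : 0 < normc z by apply: H; rewrite inE eqxx.
  exists (Order.min A (normc z / 2)); first by rewrite lt_min A0 divr_gt0 //= ge_min A1.
  have m1 : Order.min A (normc z / 2) <= A by rewrite ge_min lexx.
  have m2 : Order.min A (normc z / 2) <= normc z / 2 by rewrite ge_min lexx orbT.
  by move=> y; rewrite inE => /predU1P[->|/HA]; lra.
have [mu1 Hmu1] := opX_small oE a1' A0.
pose c := normc (lead_coef p) * \prod_(z <- zs) A.
have c0 : 0 < c by rewrite mulr_gt0 //; apply: prodr_gt0.
exists c^-1, mu1; split; first by rewrite invr_ge0 ltW.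
move=> j mu /Hmu1; rewrite indicialE -/p pE /opw; move: (opX o mu) => x xs.
apply: (@le_trans _ _ 1).
  rewrite oE /= hornerXn normcX; apply: exprn_ile1; rewrite ?normc_ge0 //.
  exact: le_trans xs A1.
rewrite ler_pdivlMl // mulr1 /c ler_wpM2l ?normc_ge0 //.
rewrite big_seq [leRHS]big_seq; apply: ler_prod => z /HA zA; rewrite (ltW A0) /=.
rewrite -normcN opprB; apply: le_trans (normcB_ge z x); lra.
Qed.

Lemma indicial_zeros phi j0 : phi j0 != 0 ->
  exists E : seq R, uniq E /\ forall mu, (mu \in E) = (indicial o phi mu == 0).
Proof.
move=> nz; have p0 := indicial_poly_neq0 nz.
have [r pE] := closed_field_poly_normal (indicial_poly phi).
have fin : finite_set (opX o @^-1` [set` r]).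
  by apply: finite_preimage; [move=> x y _ _; exact: opX_inj|apply/finite_seqP; exists r].
have : finite_set [set mu | indicial o phi mu = 0].
  apply: sub_finite_set fin => mu /=; rewrite indicialE pE hornerZ => /eqP.
  rewrite mulf_eq0 lead_coef_eq0 (negbTE p0) /= => rt.
  by rewrite -root_prod_XsubC.
move=> /finite_seqP[E HE]; exists (undup E); split; first exact: undup_uniq.
move=> mu; rewrite mem_undup; apply/idP/eqP => [muE|H].
  by have : [set` E] mu by []; rewrite -HE.
by have : [set` E] mu by rewrite -HE.
Qed.

End IndicialGrowth.

(** * Leading terms and indicial roots *)

Section LeadingTerms.
Variable R : realType.
Local Notation C := R[i].

Lemma seq_min (S : seq R) x0 : x0 \in S ->
  exists2 x, x \in S & forall y, y \in S -> x <= y.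
Proof.
elim: S x0 => // x S IH x0 _; case: S IH => [_|y S IH].
  by exists x; rewrite ?inE // => y; rewrite inE => /eqP ->.
have [z zS Hz] := IH y (mem_head _ _).
have [xz|zx] := leP x z.
  exists x; rewrite ?mem_head // => t; rewrite inE => /predU1P[-> //|/Hz].
  exact: le_trans.
exists z; first by rewrite inE zS orbT.
by move=> t; rewrite inE => /predU1P[->|/Hz //]; exact: ltW.
Qed.

Lemma seq_gap (S : seq R) nu : (forall x, x \in S -> nu < x) ->
  exists2 d, 0 < d <= 1 & forall x, x \in S -> nu + d <= x.
Proof.
elim: S => [|x S IH] H; first by exists 1; rewrite ?ltr01 ?lexx.
have [y yS|d /andP[d0 d1] Hd] := IH; first by apply: H; rewrite inE yS orbT.
have nx : nu < x by apply: H; rewrite mem_head.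
exists (Order.min d (x - nu)); first by rewrite lt_min d0 subr_gt0 nx ge_min d1.
have m1 : Order.min d (x - nu) <= d by rewrite ge_min lexx.
have m2 : Order.min d (x - nu) <= x - nu by rewrite ge_min lexx orbT.
by move=> y; rewrite inE => /predU1P[->|/Hd]; lra.
Qed.

(** Discreteness of the support isolates the leading exponent by a gap [d], which becomes the step
    of the majorant induction. *)
Lemma is_gps_order (f : R -> C) mu0 : is_gps f -> f mu0 != 0 ->
  exists nu d, [/\ f nu != 0, 0 < d <= 1
    & forall mu, f mu != 0 -> mu = nu \/ nu + d <= mu].
Proof.
move=> gf f0; have [S [uS HS]] := is_gps_seq (mu0 + 1) gf.
have [|nu nuS Hnu] := @seq_min S mu0; first by rewrite HS f0 ltrDl ltr01.
have [|d /andP[d0 d1] Hd] := @seq_gap (rem nu S) nu.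
  move=> x; rewrite (mem_rem_uniq _ uS) inE => /andP[xnu /Hnu].
  by rewrite lt_neqAle eq_sym xnu.
have nu0 : nu <= mu0 by apply: Hnu; rewrite HS f0 ltrDl ltr01.
have := nuS; rewrite HS => /andP[fnu _].
exists nu, d; split=> //; first by rewrite d0.
move=> mu fmu; have [lt1|ge1] := ltP mu (mu0 + 1); last by right; lra.
have [->|ne] := eqVneq mu nu; [by left|right; apply: Hd].
by rewrite (mem_rem_uniq _ uS) inE ne HS fmu.
Qed.

Variables (o : sigma_op R) (n : nat).
Local Notation e j := (opshift o * j%:R).

(** Shifting the support of [a j] by [e j] offsets the exponent lost by the [j]-th iterate, so all
    terms [phi j * x^(nu + e j)] act at the same level. The series [g] has the union of the shifted
    supports as support; its order is [nu] and its gap is [d]. *)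
Lemma leading_terms (a : 'I_n.+1 -> gps R) j0 : a j0 != 0 ->
  exists nu d (phi : 'I_n.+1 -> C) j1, [/\ 0 < d <= 1, phi j1 != 0
    & forall j : 'I_n.+1, ord_ge (nu + e j + d) (a j - gmono (phi j) (nu + e j))].
Proof.
move=> a0; pose g mu : C := if [exists j : 'I_n.+1, a j (mu + e j) != 0] then 1 else 0.
have gE mu : (g mu != 0) = [exists j : 'I_n.+1, a j (mu + e j) != 0].
  by rewrite /g; case: ifP; rewrite ?oner_eq0 ?eqxx.
have gg : is_gps g.
  apply: is_gpsP => M.
  pose suppl (j : 'I_n.+1) (S : seq R) := forall mu, a j (mu + e j) != 0 -> mu < M -> mu \in S.
  have [S HS] : exists S, forall j, suppl j (S j).
    apply: (@fin_all_exists _ (fun=> seq R) suppl) => j.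
    have [S [_ HS]] := is_gps_seq M (is_gps_shift (e j) (gcoefP (a j))).
    by exists S => mu amu muM; rewrite HS amu.
  exists (flatten [seq S j | j <- enum 'I_n.+1]) => mu; rewrite gE => /existsP[j aj] muM.
  apply/flattenP; exists (S j); first by rewrite map_f // mem_enum.
  exact: HS.
have [mu0 mu00] : exists mu, a j0 mu != 0.
  apply: contrapT => /forallNP H; move/eqP: a0; apply; apply: gpsP => mu.
  by have := H mu; rewrite gcoef0 => /negP; rewrite negbK => /eqP.
have [|nu [d [gnu d01 Hd]]] := is_gps_order (mu0 := mu0 - e j0) gg.
  by rewrite gE; apply/existsP; exists j0; rewrite subrK.
move: gnu; rewrite gE => /existsP[j1 j1P].
exists nu, d, (fun j => a j (nu + e j)), j1; split=> // j mu; rewrite gcoefB gmonoE.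
case: (mu =P nu + e j) => [->|ne]; first by rewrite subrr eqxx.
rewrite subr0 => amu; have [|E|] := Hd (mu - e j).
- by rewrite gE; apply/existsP; exists j; rewrite subrK.
- by case: ne; rewrite -E subrK.
- lra.
Qed.

Section Roots.
Variables (a : 'I_n.+1 -> gps R) (nu d : R) (phi : 'I_n.+1 -> C).
Hypothesis d0 : 0 < d.
Hypothesis lead : forall j : 'I_n.+1,
  ord_ge (nu + e j + d) (a j - gmono (phi j) (nu + e j)).

(** If [mu] is the leading exponent of [z], the coefficient of [x^(nu + mu)] in the image is
    [Phi(mu) z_mu]. *)
Lemma indicial_order (z : gps R) : z != 0 -> \sum_j a j * gop o j z = 0 ->
  exists2 mu, z mu != 0 & indicial o phi mu = 0.
Proof.
move=> z0 Lz; have [mu1 mu10] : exists mu, z mu != 0.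
  apply: contrapT => /forallNP H; move/eqP: z0; apply; apply: gpsP => mu.
  by have := H mu; rewrite gcoef0 => /negP; rewrite negbK => /eqP.
have [mu [d' [zmu /andP[d'0 _] Hmu]]] := is_gps_order (gcoefP z) mu10.
exists mu => //.
have ozmu : ord_ge mu z by move=> x /Hmu[->|]; lra.
have oh (j : 'I_n.+1) : ord_ge (nu + mu + d) ((a j - gmono (phi j) (nu + e j)) * gop o j z).
  apply: (@ord_ge_le _ _ (nu + e j + d + (mu - e j))); first by lra.
  by apply: ord_geM; [exact: lead|exact: gop_ord_ge].
have := congr1 (fun f : gps R => f (nu + mu)) Lz; rewrite gcoef0.
have -> : \sum_j a j * gop o j z = \sum_j gmono (phi j) (nu + e j) * gop o j z +
    \sum_j (a j - gmono (phi j) (nu + e j)) * gop o j z.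
  by rewrite -big_split /=; apply: eq_bigr => j _; rewrite -mulrDl addrC subrK.
rewrite gcoefD [X in _ + X](_ : _ = 0) ?addr0; last first.
  have os : ord_ge (nu + mu + d) (\sum_j (a j - gmono (phi j) (nu + e j)) * gop o j z).
    by apply: ord_ge_sum.
  apply/eqP; apply: contraT => /os H.
  by exfalso; move: H; rewrite leNgt ltrDl d0.
rewrite gcoef_sum => H; apply/eqP; rewrite -(mulIr_eq0 _ (mulIf zmu)) -H mulr_suml.
apply/eqP/eq_bigr => j _; rewrite gcoef_monoM gopE mulrA.
by have -> : nu + mu - (nu + e j) + e j = mu by ring.
Qed.

(** Instead of reducing the solutions to distinct leading exponents, one reads their coefficients at
    the zeros [E] of [Phi]. A combination vanishing on all of [E] is a solution with no admissible
    leading exponent, hence zero; so this matrix has rank [n] and [E] has at least [n] elements. *)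
Lemma indicial_roots (z : 'I_n -> gps R) j1 : op_ok o -> phi j1 != 0 ->
  (forall i, \sum_j a j * gop o j (z i) = 0) ->
  (forall c : 'I_n -> C, \sum_i gconst (c i) * z i = 0 -> forall i, c i = 0) ->
  exists rs : seq R, [/\ uniq rs, size rs = n & forall mu, mu \in rs -> indicial o phi mu = 0].
Proof.
move=> oP nz Lz zfree; have [E [uE HE]] := indicial_zeros oP nz.
pose M := \matrix_(i < n, k < size E) z i E`_k.
have rM : row_free M.
  apply: inj_row_free => v vM; pose y := \sum_i gconst (v 0 i) * z i.
  have yE k : (k < size E)%N -> y E`_k = 0.
    move=> kE; have := congr1 (fun A : 'rV_(size E) => A 0 (Ordinal kE)) vM.
    rewrite !mxE => <-; rewrite gcoef_sum; apply: eq_bigr => i _.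
    by rewrite mxE gcoef_constM.
  have [y0|y0] := eqVneq y 0.
    by apply/rowP => i; rewrite mxE (zfree (fun i => v 0 i)).
  have Ly : \sum_j a j * gop o j y = 0.
    transitivity (\sum_j \sum_i gconst (v 0 i) * (a j * gop o j (z i))).
      apply: eq_bigr => j _; rewrite (_ : gop o j y = \sum_i gconst (v 0 i) * gop o j (z i)).
        by rewrite mulr_sumr; apply: eq_bigr => i _; rewrite mulrCA.
      apply: gpsP => mu; rewrite gopE !gcoef_sum mulr_sumr; apply: eq_bigr => i _.
      by rewrite !gcoef_constM gopE mulrCA.
    rewrite exchange_big big1 // => i _; rewrite -mulr_sumr Lz mulr0 //.
  have [mu ymu /eqP] := indicial_order y0 Ly; rewrite -HE => muE.
  by move/eqP: ymu; case; rewrite -(nth_index 0 muE) yE // index_mem.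
have nE : (n <= size E)%N by rewrite -(eqP rM) rank_leq_col.
exists (take n E); split; first exact: take_uniq.
  by rewrite size_take; case: ltngtP nE.
by move=> mu /mem_take; rewrite HE => /eqP.
Qed.

End Roots.
End LeadingTerms.

(** * Rational coordinates and the linearized equation *)

Section RationalCoordinates.
Variables (R : realType) (m : nat) (e : 'I_m -> R).
Local Notation C := R[i].
Local Notation comb q := (\sum_i ratr (q i) * e i).

Definition Qindep := forall q : 'I_m -> rat, comb q = 0 -> forall i, q i = 0.

Definition Qsub : set R := [set x | exists q : 'I_m -> rat, x = comb q].

Lemma combD (q q' : 'I_m -> rat) : comb q + comb q' = comb (fun i => q i + q' i).
Proof. by rewrite -big_split; apply: eq_bigr => i _; rewrite rmorphD mulrDl. Qed.

Lemma combN (q : 'I_m -> rat) : - comb q = comb (fun i => - q i).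
Proof. by rewrite -sumrN; apply: eq_bigr => i _; rewrite rmorphN mulNr. Qed.

Lemma Qsub0 : Qsub 0.
Proof. by exists (fun=> 0); rewrite big1 // => i _; rewrite rmorph0 mul0r. Qed.

Lemma QsubD x y : Qsub x -> Qsub y -> Qsub (x + y).
Proof. by move=> [q ->] [q' ->]; rewrite combD; eexists. Qed.

Lemma QsubN x : Qsub x -> Qsub (- x).
Proof. by move=> [q ->]; rewrite combN; eexists. Qed.

Lemma QsubZ (a : rat) x : Qsub x -> Qsub (ratr a * x).
Proof.
move=> [q ->]; exists (fun i => a * q i); rewrite mulr_sumr.
by apply: eq_bigr => i _; rewrite rmorphM mulrA.
Qed.

Lemma Qsub_gen i : Qsub (e i).
Proof.
exists (fun j => (j == i)%:R); rewrite (bigD1 i) //= big1 => [|j /negbTE ->].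
  by rewrite eqxx rmorph1 mul1r addr0.
by rewrite rmorph0 mul0r.
Qed.

(** Outside the span the coordinates take the default value 0; only their values on [Qsub] are
    specified. *)
Lemma Qcoord : Qindep ->
  exists co : R -> 'I_m -> rat, forall q, co (comb q) = q.
Proof.
move=> free; pose coords x (q : 'I_m -> rat) := forall q', x = comb q' -> q = q'.
have [x|co H] := @choice _ _ coords; last by exists co => q; apply: H.
have [[q ->]|N] := pselect (Qsub x); last first.
  by exists (fun=> 0) => q' E; case: N; exists q'.
exists q => q' E; apply/funext => i; apply/eqP; rewrite -subr_eq0; apply/eqP.
by apply: (free (fun i => q i - q' i)); rewrite -(combD q) -combN E subrr.
Qed.

Variable co : R -> 'I_m -> rat.
Hypothesis coE : forall q, co (comb q) = q.

Lemma coD x y : Qsub x -> Qsub y -> co (x + y) = (fun i => co x i + co y i).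
Proof. by move=> [q ->] [q' ->]; rewrite combD !coE. Qed.

Lemma coZ (a : rat) x : Qsub x -> co (ratr a * x) = (fun i => a * co x i).
Proof.
move=> [q ->]; rewrite coE mulr_sumr.
have -> : \sum_i ratr a * (ratr (q i) * e i) = comb (fun i => a * q i).
  by apply: eq_bigr => i _; rewrite rmorphM mulrA.
by rewrite coE.
Qed.

Lemma co_gen i : co (e i) = (fun j => (j == i)%:R).
Proof.
rewrite -[in LHS](_ : comb (fun j => (j == i)%:R) = e i) ?coE //.
rewrite (bigD1 i) //= big1 => [|j /negbTE ->].
  by rewrite eqxx rmorph1 mul1r addr0.
by rewrite rmorph0 mul0r.
Qed.

(** The functional with value [d i] at [e i]. Complex values make complex combinations of weights
    again weights of this kind. *)
Definition colin (d : 'I_m -> C) (x : R) : C := \sum_i d i * ratr (co x i).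

Lemma colin_additive d : additive_on Qsub (colin d).
Proof.
split; [exact: Qsub0|exact: QsubD|move=> x y Ux Uy].
by rewrite -big_split; apply: eq_bigr => i _; rewrite coD // rmorphD mulrDr.
Qed.

Lemma colinZ d (a : rat) x : Qsub x -> colin d (ratr a * x) = ratr a * colin d x.
Proof.
move=> Ux; rewrite /colin mulr_sumr; apply: eq_bigr => i _.
by rewrite coZ // rmorphM mulrCA.
Qed.

Lemma colin_gen d i : colin d (e i) = d i.
Proof.
rewrite /colin co_gen (bigD1 i) //= big1 => [|j /negbTE ->].
  by rewrite eqxx rmorph1 mulr1 addr0.
by rewrite rmorph0 mulr0.
Qed.

Lemma colin_Qspan d (A : set R) : A `<=` Qsub ->
  (forall x, A x -> colin d x = 0) -> forall x, Qspan A x -> Qsub x /\ colin d x = 0.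
Proof.
move=> AU A0 _ [k [q [y [Ay ->]]]]; have [_ UD lD] := colin_additive d.
elim/big_ind: _ => [|x x' [Ux x0] [Ux' x'0]|i _].
- by split; [exact: Qsub0|exact: additive_on0 (colin_additive d)].
- by split; [exact: QsubD|rewrite lD // x0 x'0 addr0].
- by split; [exact/QsubZ/AU|rewrite colinZ ?A0 ?mulr0 //; exact: AU].
Qed.

End RationalCoordinates.

Section Linearized.
Variables (R : realType) (o : sigma_op R) (n : nat) (f : gps R).
Local Notation C := R[i].
Local Notation gev := (mmap (@gconst R)).
Implicit Types (Q : {mpoly C[n.+2]}).

Definition linearized Q (z : gps R) : gps R :=
  \sum_(j < n.+1) gev (gvars o f) Q^`M(lift ord0 j) * gop o j z.

(** The chain rule yields the linearized equation once two terms are under control: the contribution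
    of [x], killed by [l 1 = 0] or by absence of [x] from [Q], and the commutator with the operator,
    which for d/dx vanishes when [l] ignores shifts by 1. *)
Lemma linearized_weight Q (U : set R) (l : R -> C) :
  additive_on U l -> U 1 -> (forall x, U x -> U (- x)) -> supp f `<=` U ->
  l 1 = 0 \/ Q^`M(ord0) = 0 -> (opshift o = 1 -> l 1 = 0) ->
  gev (gvars o f) Q = 0 -> linearized Q (gweight l f) = 0.
Proof.
move=> Ul U1 UN fU l1 ol1 Q0; have [U0 UD lD] := Ul.
have Unat (k : nat) : U k%:R by elim: k => [//|k IH]; rewrite -nat1r; exact: UD.
have Ush (k : nat) : U (opshift o * k%:R).
  by case: (o) => [||a t] /=; rewrite ?mul1r ?mul0r.
have lsh (k : nat) : l (opshift o * k%:R) = 0.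
  have l0 := additive_on0 Ul; have : opshift o = 0 \/ opshift o = 1.
    by case: (o) => [||a t]; [right|left|left].
  case=> [->|o1]; first by rewrite mul0r.
  rewrite o1 mul1r; elim: k => [//|k IH].
  by rewrite -nat1r lD // IH addr0; exact: ol1.
have varsU i : supp (gvars (n := n) o f i) `<=` U.
  rewrite /gvars; case: (unlift ord0 i) => [j|] mu mu0.
    move: (mu0 : gop o j f mu != 0); rewrite gopE mulf_eq0 negb_or => /andP[_ /fU H].
    by rewrite -[mu](addrK (opshift o * j%:R)); apply: UD => //; apply: UN.
  by move: mu0; rewrite /supp /= gmonoE; case: (mu =P 1) => [->|]; rewrite ?eqxx.
have := gweight_chain Q Ul varsU; rewrite Q0.
have -> : gweight l 0 = 0 by apply: gpsP => mu /=; rewrite gcoef0 mulr0.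
rewrite big_ord_recl [X in _ = X + _](_ : _ = 0) ?add0r; last first.
  case: l1 => [l1|->]; last by rewrite raddf0 mul0r.
  rewrite gvars0 (_ : gweight l _ = 0) ?mulr0 //; apply: gpsP => mu /=.
  by rewrite gmonoE; case: (mu =P 1) => [->|_]; rewrite ?l1 ?mul0r ?mulr0.
move=> H; rewrite [RHS]H; apply: eq_bigr => j _; congr (_ * _).
apply: gpsP => mu; rewrite gvarsS [LHS]gopE [LHS]/=.
have -> : gweight l (gop o j f) mu = l mu * gop o j f mu by [].
rewrite gopE [LHS]mulrCA.
have [->|/fU Uf] := eqVneq (f (mu + opshift o * j%:R)) 0; first by rewrite !mulr0.
have Umu : U mu by rewrite -[mu](addrK (opshift o * j%:R)); apply: UD => //; apply: UN.
by rewrite lD // lsh addr0.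
Qed.

End Linearized.

(** * Translation invariance for d/dx *)

Section Autonomous.
Variables (R : realType) (n : nat) (f : gps R).
Local Notation C := R[i].
Local Notation gev := (mmap (@gconst R)).
Local Notation o := (DerivOp R).

Lemma gop1_deriv (g : gps R) : gop o 1 g = gmono 1 (-1) * gweight (real_complex R) g.
Proof.
apply: gpsP => mu; rewrite gcoef_monoM mul1r opprK.
by [].
Qed.

Lemma gop_comm1 j (g : gps R) : gop o j (gop o 1 g) = gop o 1 (gop o j g).
Proof. by apply: gpsP => mu; rewrite /= /op_iter -iterSr. Qed.

(** The weight [mu] is the derivation x d/dx; dividing its chain rule by [x] differentiates the
    equation itself. *)
Lemma linearized_deriv (Q : {mpoly C[n.+2]}) : Q^`M(ord0) = 0 ->
  gev (gvars o f) Q = 0 -> linearized o f Q (gop o 1 f) = 0.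
Proof.
move=> Qx Q0; have UT : additive_on [set: R] (real_complex R).
  by split=> // x y _ _; rewrite rmorphD.
have varsU i : supp (gvars (n := n) o f i) `<=` [set: R] by [].
have := gweight_chain Q UT varsU; rewrite Q0.
have -> : gweight (real_complex R) 0 = 0 by apply: gpsP => mu /=; rewrite gcoef0 mulr0.
rewrite big_ord_recl Qx raddf0 mul0r add0r => H.
transitivity (gmono 1 (-1) * (0 : gps R)); last by rewrite mulr0.
rewrite [X in _ * X]H mulr_sumr; apply: eq_bigr => j _.
by rewrite gop_comm1 gop1_deriv gvarsS mulrCA.
Qed.

End Autonomous.

(** * An equation with nonzero linearization *)

Section MinimalEquation.
Variables (R : realType) (o : sigma_op R) (n : nat) (f : gps R).
Local Notation C := R[i].
Local Notation gev := (mmap (@gconst R)).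
Implicit Types (P Q : {mpoly C[n.+2]}).

(** In characteristic zero such a [Q] involves [x] only, and distinct powers of [x] cannot
    cancel. *)
Lemma gev_nonconst Q : Q != 0 -> (forall j : 'I_n.+1, Q^`M(lift ord0 j) = 0) ->
  gev (gvars o f) Q != 0.
Proof.
move=> Q0 dQ.
have my m (j : 'I_n.+1) : m \in msupp Q -> m (lift ord0 j) = 0%N.
  move=> mQ; apply: contraTeq mQ; rewrite -lt0n => mj.
  have E : m = ((m - U_(lift ord0 j)) + U_(lift ord0 j))%MM.
    rewrite submK //; apply/mnm_lepP => i; rewrite mnm1E.
    by case: eqP => [<-|].
  have := congr1 (fun p : {mpoly C[n.+2]} => p@_(m - U_(lift ord0 j))) (dQ j).
  rewrite mcoeff_deriv -E mcoeff0 => /eqP; rewrite mulrn_eq0 /= mcoeff_msupp => ->.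
  by [].
apply/eqP => /(congr1 (fun g : gps R => g (mlead Q ord0)%:R)); rewrite gcoef0.
rewrite /mmap gcoef_sum (bigD1_seq (mlead Q)) ?msupp_uniq ?mlead_supp //=.
have term m : m \in msupp Q -> mmap1 (gvars o f) m = gmono 1 (m ord0)%:R.
  move=> mQ; rewrite /mmap1 big_ord_recl gvars0 gmonoX big1 ?mulr1 // => j _.
  by rewrite my // expr0.
rewrite term ?mlead_supp // gcoef_constM gmonoE eqxx mulr1.
rewrite big1_seq ?addr0 => [/eqP|m /andP[mne mQ]]; first by rewrite mleadc_eq0; exact/negP.
rewrite term // gcoef_constM gmonoE eqr_nat; case: eqP => [E|]; last by rewrite mulr0.
move/eqP: mne; case; apply/mnmP => i; have [j|] := unliftP ord0 i => ->; last by rewrite E.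
by rewrite !my ?mlead_supp.
Qed.

(** If all partial derivatives in the [y_j] vanish at [f], any nonzero one is a smaller equation for
    [f]; the descent is on [msize]. The class [cl] records what must be inherited by derivatives. *)
Lemma minimal_equation P (cl : {mpoly C[n.+2]} -> Prop) :
  (forall Q i, cl Q -> cl Q^`M(i)) -> cl P -> P != 0 -> gev (gvars o f) P = 0 ->
  exists Q, [/\ cl Q, gev (gvars o f) Q = 0
    & exists j : 'I_n.+1, gev (gvars o f) Q^`M(lift ord0 j) != 0].
Proof.
move=> cld; have [k] := ubnP (msize P); elim: k P => // k IH P szP clP P0 PE.
have [H|/forallNP H] := pselect (exists j : 'I_n.+1, gev (gvars o f) P^`M(lift ord0 j) != 0).
  by exists P.
have {}H (j : 'I_n.+1) : gev (gvars o f) P^`M(lift ord0 j) = 0.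
  by have := H j => /negP; rewrite negbK => /eqP.
have [dP|] := pselect (forall j : 'I_n.+1, P^`M(lift ord0 j) = 0).
  by have := gev_nonconst P0 dP; rewrite PE eqxx.
move=> /existsNP[j /eqP dP]; apply: (IH P^`M(lift ord0 j)) => //; last exact: cld.
by apply: leq_trans (msize_mderiv dP) _; rewrite -ltnS.
Qed.

End MinimalEquation.

(** * Solutions of the linearized equation in maximal rank *)

Section MaximalRank.
Variable R : realType.
Local Notation C := R[i].
Local Notation gev := (mmap (@gconst R)).

Lemma Qspan_sub (A : set R) a : A a -> Qspan A a.
Proof.
move=> Aa; exists 1%N, (fun=> 1), (fun=> a); split=> //.
by rewrite big_ord1 rmorph1 mul1r.
Qed.

Lemma Qspan_ratr (A : set R) a : (forall x, A x -> exists k : nat, x = k%:R) ->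
  Qspan A a -> exists q : rat, a = ratr q.
Proof.
move=> Anat [k [q [e [Ae ->]]]]; elim/big_ind: _ => [|x y [p ->] [p' ->]|i _].
- by exists 0; rewrite rmorph0.
- by exists (p + p'); rewrite rmorphD.
- have [m ->] := Anat _ (Ae i); exists (q i * m%:R).
  by rewrite rmorphM rmorph_nat.
Qed.

Lemma Qspan_eq0 (A : set R) a : (forall x, A x -> x = 0) -> Qspan A a -> a = 0.
Proof.
by move=> A0 [k [q [e [Ae ->]]]]; rewrite big1 // => i _; rewrite (A0 _ (Ae i)) mulr0.
Qed.

Lemma suppP_nat n (P : {mpoly C[n.+2]}) x : suppP P x -> exists k : nat, x = k%:R.
Proof. by move=> [m _ <-]; exists (m ord0). Qed.

Section Weights.
Variables (m : nat) (e : 'I_m -> R) (co : R -> 'I_m -> rat) (f : gps R).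
Hypothesis coE : forall q, co (\sum_i ratr (q i) * e i) = q.

Definition delta (i : 'I_m) : 'I_m -> C := fun j => (j == i)%:R.

Lemma gweight_colin_sum n (c : 'I_n -> C) (D : 'I_n -> 'I_m -> C) :
  \sum_i gconst (c i) * gweight (colin co (D i)) f =
  gweight (colin co (fun k => \sum_i c i * D i k)) f.
Proof.
apply: gpsP => mu; rewrite gcoef_sum /= /colin mulr_suml.
under [RHS]eq_bigr do rewrite !mulr_suml.
rewrite [RHS]exchange_big; apply: eq_bigr => i _.
rewrite gcoef_constM /= mulr_suml mulr_sumr; apply: eq_bigr => k _.
by rewrite !mulrA.
Qed.

(** Source of linear independence: a functional whose weight kills [f] vanishes on the support of
    [f], hence on a span containing the [v i]. *)
Lemma gweight_colin0 (A : set R) d : A `<=` Qsub e -> supp f `<=` A ->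
  (forall x, A x -> f x != 0 \/ colin co d x = 0) ->
  gweight (colin co d) f = 0 ->
  forall x, Qspan A x -> Qsub e x /\ colin co d x = 0.
Proof.
move=> AU fA Af H; apply: (colin_Qspan coE AU) => x /Af[fx|//].
have /eqP := congr1 (fun g : gps R => g x) H; rewrite /= gcoef0 mulf_eq0 (negbTE fx) orbF.
by move/eqP.
Qed.

End Weights.

Variables (o : sigma_op R) (n : nat) (P : {mpoly C[n.+2]}) (f : gps R).

(** The class [cl] lets the series be chosen before the equation [Q] found by [minimal_equation]. *)
Definition linearized_solutions (z : 'I_n -> gps R) (cl : {mpoly C[n.+2]} -> Prop) :=
  [/\ cl P, forall Q i, cl Q -> cl Q^`M(i),
      forall Q, cl Q -> gev (gvars o f) Q = 0 -> forall i, linearized o f Q (z i) = 0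
    & forall c : 'I_n -> C, \sum_i gconst (c i) * z i = 0 -> forall i, c i = 0].

Variable v : 'I_n -> R.
Local Notation A := (supp f `|` suppP P).
Hypothesis vA : forall i, Qspan A (v i).

(** Here 1 can join the [v i] in a basis, and the functionals dual to the [v i] vanish at 1, so they
    kill [x] and suit every [Q]. *)
Lemma solutions_generic :
  (forall (q0 : rat) (q : 'I_n -> rat), ratr q0 + \sum_i ratr (q i) * v i = 0 ->
     q0 = 0 /\ forall i, q i = 0) ->
  (forall a, Qspan A a -> exists (q : 'I_n -> rat) (b : R),
     Qspan (suppP P) b /\ a = b + \sum_i ratr (q i) * v i) ->
  exists z cl, linearized_solutions z cl.
Proof.
move=> free1 vspan.
pose e (i : 'I_n.+1) : R := if unlift ord0 i is Some j then v j else 1.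
have combE (q : 'I_n.+1 -> rat) : \sum_i ratr (q i) * e i =
    ratr (q ord0) + \sum_i ratr (q (lift ord0 i)) * v i.
  rewrite big_ord_recl /e unlift_none mulr1; congr (_ + _).
  by apply: eq_bigr => i _; rewrite liftK.
have e0 : e ord0 = 1 by rewrite /e unlift_none.
have eS i : e (lift ord0 i) = v i by rewrite /e liftK.
have free : Qindep e.
  move=> q; rewrite combE => /free1[q0 qS] i.
  by have [j|] := unliftP ord0 i => ->.
have [co coE] := Qcoord free.
have AU : A `<=` Qsub e.
  move=> a /Qspan_sub/vspan[q [b [/(Qspan_ratr (@suppP_nat _ _))[q0 ->] ->]]].
  exists (fun i => if unlift ord0 i is Some j then q j else q0).
  rewrite combE unlift_none; congr (_ + _).
  by apply: eq_bigr => i _; rewrite liftK.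
have U1 : Qsub e 1 by rewrite -e0; exact: Qsub_gen.
have D1 i : colin co (delta (lift ord0 i)) 1 = 0.
  by rewrite -e0 (colin_gen coE) /delta (negbTE (neq_lift _ _)).
exists (fun i => gweight (colin co (delta (lift ord0 i))) f), (fun=> True).
split=> // [Q _ Q0 i|c].
  apply: (linearized_weight (U := Qsub e)) => //.
  - exact: colin_additive.
  - exact: QsubN.
  - by move=> x fx; apply: AU; left.
  - by left.
rewrite gweight_colin_sum; set d := (X in colin co X) => H i.
have dE j : d (lift ord0 j) = c j.
  rewrite /d (bigD1 j) //= big1 => [|k kj]; first by rewrite /delta eqxx mulr1 addr0.
  by rewrite /delta (inj_eq lift_inj) eq_sym (negbTE kj) mulr0.
have d0 : d ord0 = 0.
  by rewrite /d big1 // => j _; rewrite /delta (negbTE (neq_lift _ _)) mulr0.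
have A0 x : A x -> f x != 0 \/ colin co d x = 0.
  move=> [fx|/suppP_nat[k ->]]; [by left|right].
  have -> : (k%:R : R) = ratr k%:R * 1 by rewrite mulr1 rmorph_nat.
  by rewrite (colinZ coE) // -e0 (colin_gen coE) d0 mulr0.
have [_] := gweight_colin0 coE AU (@subsetUl _ _ _) A0 H (vA i).
by rewrite -eS (colin_gen coE) dE.
Qed.

(* When [1] is a rational combination of the [v i] the equation is autonomous.
   The weights killing [1] only give [n - 1] solutions of the linearized
   equation for d/dx, and invariance under translation provides the missing
   one, [s']. *)
Lemma solutions_autonomous (t : 'I_n -> rat) :
  Qindep v -> 1 = \sum_i ratr (t i) * v i ->
  (forall x, suppP P x -> x = 0) -> P^`M(ord0) = 0 ->
  (forall a, Qspan A a -> Qsub v a) ->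
  exists z cl, linearized_solutions z cl.
Proof.
move=> free t1 P0 Px vspan; have [co coE] := Qcoord free.
have AU : A `<=` Qsub v by move=> a /Qspan_sub/vspan.
have fU : supp f `<=` Qsub v by move=> a fa; apply: AU; left.
have U1 : Qsub v 1 by exists t.
have cld (Q : {mpoly C[n.+2]}) i : Q^`M(ord0) = 0 -> (Q^`M(i))^`M(ord0) = 0.
  by move=> Q0; rewrite mderiv_comm Q0 mderiv0.
have A0 d x : A x -> f x != 0 \/ colin co d x = 0.
  move=> [fx|/P0 ->]; [by left|right].
  exact: additive_on0 (colin_additive coE d).
have fA : supp f `<=` A by exact: subsetUl.
have d0 d : gweight (colin co d) f = 0 -> forall i, d i = 0.
  move=> H i; have [_] := gweight_colin0 coE AU fA (A0 d) H (vA i).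
  by rewrite (colin_gen coE).
have [oD|oD] := pselect (opshift o = 1); last first.
  exists (fun i => gweight (colin co (delta i)) f), (fun Q => Q^`M(ord0) = 0).
  split=> // [Q Qx Q0 i|c].
    apply: (linearized_weight (U := Qsub v)) => //; [exact: colin_additive|exact: QsubN|by right].
  rewrite gweight_colin_sum => /d0 H i; rewrite -(H i) (bigD1 i) //= big1 => [|k kj].
    by rewrite /delta eqxx mulr1 addr0.
  by rewrite /delta eq_sym (negbTE kj) mulr0.
have {oD} oE : o = DerivOp R.
  by case: (o) oD => //= [|a' t'] /eqP; rewrite eq_sym oner_eq0.
have [k tk] : exists k, t k != 0.
  apply: contrapT => /forallNP H; have /eqP := t1; rewrite big1 ?oner_eq0 // => i _.
  by have := H i => /negP; rewrite negbK => /eqP ->; rewrite rmorph0 mul0r.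
have tkC : (ratr (t k) : C) != 0 by rewrite fmorph_eq0.
(* The dual functional corrected by a multiple of the [k]-th one so as to vanish at 1. *)
pose D i j : C := delta i j - ratr (t i) / ratr (t k) * delta k j.
have col1 d : colin co d 1 = \sum_i d i * ratr (t i) by rewrite [in LHS]t1 /colin coE.
have colD i : colin co (D i) 1 = 0.
  rewrite col1 /D; under eq_bigr do rewrite mulrBl.
  rewrite sumrB (bigD1 i) //= big1 => [|j ji]; last by rewrite /delta (negbTE ji) mul0r.
  rewrite (bigD1 k) //= [X in _ - (_ + X)]big1 => [|j jk]; last by rewrite /delta (negbTE jk) mulr0 mul0r.
  by rewrite /delta !eqxx !addr0 mulr1 mul1r divfK // subrr.
exists (fun i => if i == k then gop o 1 f else gweight (colin co (D i)) f).
exists (fun Q => Q^`M(ord0) = 0).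
split=> // [Q Qx Q0 i|c].
  case: eqP => _.
    by move: Q0; rewrite oE => Q0; apply: linearized_deriv.
  apply: (linearized_weight (U := Qsub v)) => //; [exact: colin_additive|exact: QsubN|by left].
pose c' i := if i == k then 0 else c i.
pose d j := \sum_i c' i * D i j.
have splitc : \sum_i gconst (c i) * (if i == k then gop o 1 f else gweight (colin co (D i)) f) =
    gconst (c k) * gop o 1 f + gweight (colin co d) f.
  rewrite -gweight_colin_sum (bigD1 k) //= eqxx [in RHS](bigD1 k) //= /c' eqxx.
  rewrite rmorph0 mul0r add0r; congr (_ + _); apply: eq_bigr => i /negbTE ik.
  by rewrite ik.
rewrite splitc => H.
have dk i : i != k -> d i = c i.
  move=> ik; rewrite /d (bigD1 i) //= big1 => [|j ji].
    by rewrite /c' (negbTE ik) /D /delta eqxx (negbTE ik) mulr0 subr0 mulr1 addr0.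
  by rewrite /D /delta eq_sym (negbTE ji) (negbTE ik) mulr0 subr0 mulr0.
have d1 : colin co d 1 = 0.
  rewrite col1 /d; under eq_bigr do rewrite mulr_suml.
  rewrite exchange_big big1 // => i _; under eq_bigr do rewrite -mulrA.
  by rewrite -mulr_sumr -col1 colD mulr0.
have coefH mu : c k * ((mu + 1)%:C * f (mu + 1)) = - (colin co d mu * f mu).
  have /eqP := congr1 (fun g : gps R => g mu) H.
  rewrite gcoef0 gcoefD gcoef_constM addr_eq0 => /eqP <-; congr (_ * _).
  by rewrite gopE oE /= !mul1r; rewrite /opw /= big_ord1 subr0 hornerX.
have [UD lD] : (forall x y, Qsub v x -> Qsub v y -> Qsub v (x + y)) /\
  forall x y, Qsub v x -> Qsub v y -> colin co d (x + y) = colin co d x + colin co d y.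
  by have [_] := colin_additive coE d.
have l0 := additive_on0 (colin_additive coE d).
(* Otherwise [coefH] propagates a nonzero exponent [mu] of [f] to [mu - 1], again nonzero, and so on
   without end, against the lower bound on the support. Then [f] is a constant and 1 cannot lie in
   the span. *)
have ck : c k = 0.
  apply/eqP; apply: contraT => ck0.
  have step mu : f mu != 0 -> mu != 0 -> f (mu - 1) != 0 /\ mu - 1 != 0.
    move=> fmu mu0; have E := coefH (mu - 1); rewrite subrK in E.
    have : - (colin co d (mu - 1) * f (mu - 1)) != 0.
      by rewrite -E !mulf_neq0 // -(rmorph0 (real_complex R)) (inj_eq (@complexI R)).
    rewrite oppr_eq0 mulf_eq0 negb_or => /andP[lmu fmu1]; split=> //.
    by apply: contraNneq lmu => ->; rewrite l0.
  have f0 mu : f mu != 0 -> mu = 0.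
    move=> fmu; apply/eqP; apply: contraT => mu0.
    have desc j : f (mu - j%:R) != 0 /\ mu - j%:R != 0.
      elim: j => [|j [fj j0]]; first by rewrite subr0.
      by rewrite -natr1 opprD addrA; apply: step.
    have [m Hm] := is_gps_lb (gcoefP f).
    have := Hm _ (desc (Num.bound `|mu - m|)).1.
    by have := archi_boundP (normr_ge0 (mu - m)); have := ler_norm (mu - m); lra.
  have v0 i : v i = 0.
    by apply: (Qspan_eq0 _ (vA i)) => x [/f0|/P0].
  by have /eqP := t1; rewrite big1 ?oner_eq0 // => i _; rewrite v0 mulr0.
move: H; rewrite ck rmorph0 mul0r add0r => /d0 d00 i.
by have [->|ik] := eqVneq i k; rewrite // -dk.
Qed.

(** The dichotomy is whether 1 is rationally independent of the [v i]. If not, [x] cannot occur in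
    [P]: otherwise the span of [suppP P] would contain every rational and the relation would
    contradict [vfree]. *)
Lemma maximal_rank_solutions :
  (forall q : 'I_n -> rat, Qspan (suppP P) (\sum_i ratr (q i) * v i) -> forall i, q i = 0) ->
  (forall a, Qspan A a -> exists (q : 'I_n -> rat) (b : R),
     Qspan (suppP P) b /\ a = b + \sum_i ratr (q i) * v i) ->
  exists z cl, linearized_solutions z cl.
Proof.
move=> vfree vspan.
have [free1|] := pselect (forall (q0 : rat) (q : 'I_n -> rat),
   ratr q0 + \sum_i ratr (q i) * v i = 0 -> q0 = 0 /\ forall i, q i = 0).
  exact: solutions_generic.
move=> /existsNP[q0 /existsNP[q /not_implyP[E N]]].
have span0 : Qspan (suppP P) 0 by exists 0%N, (fun=> 0), (fun=> 0); split=> [[]|]; rewrite ?big_ord0.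
have q00 : q0 != 0.
  apply: contra_notN N => /eqP q00; split=> //; apply: vfree.
  by move: E; rewrite q00 rmorph0 add0r => ->.
have q0R : (ratr q0 : R) != 0 by rewrite fmorph_eq0.
have P0 x : suppP P x -> x = 0.
  move=> Px; have [k xk] := suppP_nat Px; have [k0|k0] := eqVneq k 0%N; first by rewrite xk k0.
  have kR : (k%:R : R) != 0 by rewrite pnatr_eq0.
  case: N; suff qi : forall i, q i = 0.
    split=> //; apply/eqP; move: E; rewrite big1 ?addr0; last by move=> i _; rewrite qi rmorph0 mul0r.
    by move=> /eqP; rewrite fmorph_eq0.
  apply: vfree; exists 1%N, (fun=> - q0 / k%:R), (fun=> x); split=> //.
  rewrite big_ord1 xk fmorph_div rmorphN rmorph_nat divfK //.
  by apply/eqP; rewrite -addr_eq0 addrC E.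
apply: (solutions_autonomous (t := fun i => - q i / q0)).
- by move=> q' H; apply: vfree; rewrite H.
- transitivity (- (\sum_i ratr (q i) * v i) / ratr q0).
    by move/eqP: E; rewrite addr_eq0 => /eqP <-; rewrite divff.
  by rewrite -sumrN mulr_suml; apply: eq_bigr => i _; rewrite fmorph_div rmorphN mulNr mulrAC !mulNr.
- exact: P0.
- apply/mpolyP => m; rewrite mcoeff_deriv mcoeff0.
  have [->|H] := eqVneq P@_(m + U_(ord0)) 0; first by rewrite mul0rn.
  have /P0/eqP : suppP P ((m + U_(ord0))%MM ord0)%:R.
    by exists (m + U_(ord0))%MM => //=; rewrite mcoeff_msupp.
  by rewrite pnatr_eq0 mnmDE mnm1E eqxx addn1.
- by move=> a /vspan[q' [b [/(Qspan_eq0 P0) -> ->]]]; exists q'; rewrite add0r.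
Qed.

End MaximalRank.

(** * Uniform convergence *)

Section Convergence.
Variable R : realType.
Local Notation C := R[i].
Local Notation normc := Normc.normc.

(** The limit obeys every Cauchy estimate of [g] with the same [M0], which keeps the later
    convergence uniform. It is the supremum of the eventual lower bounds of [g]. *)
Lemma real_cauchy_limit (g : R -> R) :
  (forall eps, 0 < eps -> exists M0, forall M M', M0 <= M -> M0 <= M' -> `|g M - g M'| <= eps) ->
  exists L, forall eps M0, (forall M M', M0 <= M -> M0 <= M' -> `|g M - g M'| <= eps) ->
    forall M, M0 <= M -> `|g M - L| <= eps.
Proof.
move=> gC; pose A : set R := [set y | exists M0, forall M, M0 <= M -> y <= g M].
have inA eps M0 M : (forall M M', M0 <= M -> M0 <= M' -> `|g M - g M'| <= eps) ->
    M0 <= M -> A (g M - eps).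
  by move=> H MM; exists M0 => M' MM'; have := H M M' MM MM'; rewrite ler_norml; lra.
have ubA eps M0 M : (forall M M', M0 <= M -> M0 <= M' -> `|g M - g M'| <= eps) ->
    M0 <= M -> ubound A (g M + eps).
  move=> H MM y [M1 HM1]; pose M2 := Order.max M0 M1.
  have m1 : M0 <= M2 by rewrite le_max lexx.
  have m2 : M1 <= M2 by rewrite le_max lexx orbT.
  by have := HM1 _ m2; have := H M M2 MM m1; rewrite ler_norml; lra.
have [M1 HM1] := gC 1 ltr01.
have A0 : A !=set0 by exists (g M1 - 1); apply: (inA _ M1).
have Aub : has_ubound A by exists (g M1 + 1); apply: (ubA _ M1).
exists (sup A) => eps M0 H M MM.
have := ub_le_sup Aub (inA _ _ _ H MM); have := ge_sup A0 (ubA _ _ _ H MM).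
rewrite ler_norml; lra.
Qed.

Lemma normc_ge_absRe (z : C) : `|complex.Re z| <= normc z.
Proof.
by case: z => a b /=; rewrite -sqrtr_sqr ler_wsqrtr // lerDl sqr_ge0.
Qed.

Lemma normc_ge_absIm (z : C) : `|complex.Im z| <= normc z.
Proof.
by case: z => a b /=; rewrite -sqrtr_sqr ler_wsqrtr // lerDr sqr_ge0.
Qed.

Lemma normc_le_ReIm (z : C) : normc z <= `|complex.Re z| + `|complex.Im z|.
Proof.
case: z => a b /=; rewrite -[leRHS]ger0_norm ?addr_ge0 // -sqrtr_sqr ler_wsqrtr //.
rewrite sqrrD !real_normK ?num_real // addrAC lerDl mulrn_wge0 // mulr_ge0 //.
Qed.

Lemma complex_cauchy_limit (g : R -> C) :
  (forall eps, 0 < eps -> exists M0, forall M M', M0 <= M -> M0 <= M' -> normc (g M - g M') <= eps) ->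
  exists L, forall eps M0, (forall M M', M0 <= M -> M0 <= M' -> normc (g M - g M') <= eps) ->
    forall M, M0 <= M -> normc (g M - L) <= eps + eps.
Proof.
move=> gC.
have ReB (x y : C) : complex.Re (x - y) = complex.Re x - complex.Re y by case: x; case: y.
have ImB (x y : C) : complex.Im (x - y) = complex.Im x - complex.Im y by case: x; case: y.
have ReC M M' eps : normc (g M - g M') <= eps -> `|complex.Re (g M) - complex.Re (g M')| <= eps.
  by apply: le_trans; rewrite -ReB; exact: normc_ge_absRe.
have ImC M M' eps : normc (g M - g M') <= eps -> `|complex.Im (g M) - complex.Im (g M')| <= eps.
  by apply: le_trans; rewrite -ImB; exact: normc_ge_absIm.
have [|a Ha] := @real_cauchy_limit (fun M => complex.Re (g M)).
  by move=> eps /gC[M0 H]; exists M0 => M M' m m'; apply/ReC/H.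
have [|b Hb] := @real_cauchy_limit (fun M => complex.Im (g M)).
  by move=> eps /gC[M0 H]; exists M0 => M M' m m'; apply/ImC/H.
exists (a +i* b) => eps M0 H M MM; apply: le_trans (normc_le_ReIm _) _.
rewrite ReB ImB /=; apply: lerD.
  by apply: (Ha eps M0) => // M' M'' m m'; apply/ReC/H.
by apply: (Hb eps M0) => // M' M'' m m'; apply/ImC/H.
Qed.

Lemma trunc_split (s : R -> C) M0 M rho theta : is_gps s -> M0 <= M ->
  exists S : seq R, [/\ uniq S, forall mu, mu \in S -> M0 <= mu
    & trunc s M rho theta - trunc s M0 rho theta =
      \sum_(mu <- S) s mu * (rho `^ mu)%:C * cis (mu * theta)].
Proof.
move=> gs MM; have [S [uS HS]] := is_gps_seq M gs.
have truncE N (S' : seq R) : uniq S' -> (forall mu, (mu \in S') = (s mu != 0) && (mu < N)) ->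
    trunc s N rho theta = \sum_(mu <- S') s mu * (rho `^ mu)%:C * cis (mu * theta).
  move=> uS' HS'; rewrite /trunc (fsbigE S') //.
  - rewrite big_seq_cond [RHS]big_seq_cond; apply: eq_bigl => mu; rewrite andbT.
    case muS: (mu \in S') => //=; apply: mem_set => /=.
    by move: muS; rewrite HS' => /andP[].
  - by move=> mu /=; rewrite HS' => /andP[].
  - move=> mu /= muN; rewrite HS' muN andbT negbK => /eqP ->.
    by rewrite !mul0r.
exists [seq mu <- S | M0 <= mu]; split; first by rewrite filter_uniq.
  by move=> mu; rewrite mem_filter => /andP[].
rewrite (truncE M S) // (truncE M0 [seq mu <- S | ~~ (M0 <= mu)]) ?filter_uniq //.
  rewrite [X in X - _](bigID (fun mu => M0 <= mu)) /= !big_filter addrK //.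
move=> mu; rewrite mem_filter HS -ltNge andbC -andbA; congr (_ && _).
by case: (ltP mu M0) => [lt0|]; rewrite ?andbF ?andbT // (lt_le_trans lt0).
Qed.

(** A finite set whose sum is within [eps] of the supremum leaves at most [eps] for any exponents
    beyond it. *)
Lemma summable_tail (f : R -> R) K D : (forall mu, 0 <= f mu) ->
  (forall S : seq R, uniq S -> (forall mu, mu \in S -> K <= mu) -> \sum_(mu <- S) f mu <= D) ->
  forall eps, 0 < eps -> exists2 M0, K <= M0 & forall S : seq R, uniq S ->
    (forall mu, mu \in S -> M0 <= mu) -> \sum_(mu <- S) f mu <= eps.
Proof.
move=> f0 HD eps eps0.
pose A : set R := [set y | exists S : seq R,
  [/\ uniq S, forall mu, mu \in S -> K <= mu & y = \sum_(mu <- S) f mu]].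
have Asup : has_sup A.
  split; first by exists 0, [::]; split=> //; rewrite big_nil.
  by exists D => _ [S [uS SK ->]]; exact: HD.
have [_ [S0 [uS0 S0K ->]] lt0] := sup_adherent eps0 Asup.
have [M0 [KM0 HM0]] : exists M0, K <= M0 /\ forall mu, mu \in S0 -> mu < M0.
  elim: (S0) => [|x S [M0 [KM0 HM0]]]; first by exists K.
  exists (Order.max M0 (x + 1)); split; first by rewrite le_max KM0.
  move=> mu; rewrite inE lt_max => /predU1P[->|/HM0 -> //].
  by rewrite ltrDl ltr01 orbT.
exists M0 => // S uS SM.
have : \sum_(mu <- S0 ++ S) f mu <= sup A.
  apply: ub_le_sup; first by case: Asup.
  exists (S0 ++ S); split=> //.
    rewrite cat_uniq uS0 uS andbT /=; apply/hasPn => mu /SM muM.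
    by apply/negP => /HM0; rewrite ltNge muM.
  by move=> mu; rewrite mem_cat => /orP[/S0K //|/SM]; exact: le_trans.
rewrite big_cat /=; lra.
Qed.

(** Weierstrass test with majorant [|s mu| r^mu]: [|cis| = 1] removes the angle, and [K >= 0] makes
    [rho^mu] increase with [rho]. The finitely many terms below [K] cancel in differences of
    truncations. *)
Lemma summable_unif_conv (s : R -> C) r K D th0 al : is_gps s -> 0 <= K ->
  (forall S : seq R, uniq S -> (forall mu, mu \in S -> K <= mu) ->
     \sum_(mu <- S) normc (s mu) * r `^ mu <= D) ->
  unif_conv_sector s r th0 al.
Proof.
move=> gs K0 HD.
have tail := summable_tail (fun mu => mulr_ge0 (normc_ge0 (s mu)) (powR_ge0 r mu)) HD.
have cauchy eps : 0 < eps -> exists M0, forall rho theta, in_sector r th0 al rho theta ->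
    forall M M', M0 <= M -> M0 <= M' -> normc (trunc s M rho theta - trunc s M' rho theta) <= eps.
  move=> /tail[M0 KM0 H]; exists M0 => rho theta [/andP[rho0 rhor] _].
  have le M M' : M0 <= M -> M <= M' -> normc (trunc s M' rho theta - trunc s M rho theta) <= eps.
    move=> M0M MM'; have [S [uS SM ->]] := trunc_split rho theta gs MM'.
    have SM0 mu : mu \in S -> M0 <= mu by move/SM; exact: le_trans.
    apply: le_trans (H S uS SM0); apply: le_trans (normc_sum _ _) _.
    rewrite big_seq [leRHS]big_seq; apply: ler_sum => mu /SM0 M0mu.
    rewrite !Normc.normcM normc_cis mulr1 normc_real ger0_norm ?powR_ge0 //.
    have mu0 : 0 <= mu by apply: le_trans K0 _; apply: le_trans M0mu.
    have r0 : 0 <= r by rewrite ltW // (lt_trans rho0).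
    by rewrite ler_wpM2l ?normc_ge0 // ge0_ler_powR ?nnegrE // ltW.
  move=> M M' m m'; have [MM'|M'M] := leP M M'; last by apply: le => //; exact: ltW.
  by rewrite -normcN opprB; apply: le.
pose is_lim (x : R * R) (L : C) := in_sector r th0 al x.1 x.2 -> forall eps M0,
  (forall M M', M0 <= M -> M0 <= M' -> normc (trunc s M x.1 x.2 - trunc s M' x.1 x.2) <= eps) ->
  forall M, M0 <= M -> normc (trunc s M x.1 x.2 - L) <= eps + eps.
have [x|F HF] := @choice _ _ is_lim.
  have [xs|xs] := pselect (in_sector r th0 al x.1 x.2); last by exists 0.
  have [|L HL] := @complex_cauchy_limit (fun M => trunc s M x.1 x.2).
    by move=> eps /cauchy[M0 H]; exists M0; exact: H.
  by exists L => _; exact: HL.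
exists (fun rho theta => F (rho, theta)) => eps eps0.
(* Passing to the complex limit doubles the error, and [2 * eps / 3 < eps]. *)
have e3 : 0 < eps / 3 by rewrite divr_gt0.
have [M0 H] := cauchy _ e3; exists M0 => M MM rho theta rt.
rewrite -[`|_|]/((normc _)%:C) ltcR.
apply: le_lt_trans (HF (rho, theta) rt _ _ (H _ _ rt) M MM) _; lra.
Qed.

End Convergence.

Theorem theorem2 (R : realType) (n : nat) (o : sigma_op R)
    (P : mpoly.mpoly n.+2 R[i]) (s : R -> R[i]) :
  op_ok o -> P != 0 -> is_gps s ->
  eval_diff P o s = @gps_zero R ->
  quot_dim_eq (supp s `|` suppP P) (suppP P) n ->
  exists r : R, 0 < r /\
    forall th0 al : R, 0 < al < 2 * pi -> unif_conv_sector s r th0 al.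
Proof.
move=> oP P0 gs Ps [v [vA [vfree vspan]]].
pose f := Gps gs.
have fP : mmap (@gconst R) (gvars o f) P = 0.
  by apply: gpsP => mu; rewrite -eval_diffE Ps gcoef0.
have [z [cl [clP cld lin zfree]]] := @maximal_rank_solutions R o n P f v vA vfree vspan.
have [Q [clQ Q0 [j0 dQ]]] := minimal_equation cld clP P0 fP.
have [nu [d [phi [j1 [d01 phi1 lead]]]]] :=
  @leading_terms R o n (fun j => mmap (@gconst R) (gvars o f) Q^`M(lift ord0 j)) j0 dQ.
have d0 : 0 < d by case/andP: d01.
have [rs [urs szrs rsP]] := indicial_roots d0 lead oP phi1 (lin Q clQ Q0) zfree.
have [B [mu1 [B0 growth]]] := indicial_growth oP phi1 urs szrs rsP.
have [r [K [D [r0 K0 HD]]]] := majorant Q0 d01 B0 lead growth.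
by exists r; split=> // th0 al _; apply: summable_unif_conv gs K0 HD.
Qed.
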